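(* There exist a constant $s_0>0$ and a function $k\colon (0,s_0)\to[0,1)$ with $k(s)\to 0$ as $s\to 0$ such that the following holds. If $0<s<s_0$ and $\Gamma\subset\mathbb{C}$ is an $s$-quasisymmetric graph, then there is a reduced quasiconformal mapping $f\colon\mathbb{C}\to\mathbb{C}$ with constant $k(s)$ (i.e. $|f_{\bar z}|\le k(s)\,\operatorname{Re} f_z$ a.e.) such that $f(\mathbb{R})=\Gamma$.
   Context: An embedding $f\colon X\to Y$ between subsets of a Euclidean space is quasisymmetric if there is a homeomorphism $\eta\colon[0,\infty)\to[0,\infty)$ such that $|f(x)-f(a)|\le \eta(t)|f(x)-f(b)|$ with $t=|x-a|/|x-b|$ for every triple of distinct points $a,b,x\in X$. For a constant $s>0$, $f$ is $s$-quasisymmetric if $\eta$ can be chosen so that $\eta(t)\le t+s$ for $0\le t\le 1/s$. A set $\Gamma\subset\mathbb{C}$ is a quasisymmetric graph (resp. $s$-quasisymmetric graph) if the orthogonal projection $w\mapsto \operatorname{Re} w$ is a quasisymmetric (resp. $s$-quasisymmetric) homeomorphism from $\Gamma$ (with the metric induced from $\mathbb{C}$) onto $\mathbb{R}$. A nonconstant continuous mapping $f\colon\mathbb{C}\to\mathbb{C}$ in $W^{1,2}_{\rm loc}$ is reduced quasiconformal if there is a constant $k\in[0,1)$ with $|f_{\bar z}|\le k\operatorname{Re} f_z$ almost everywhere in $\mathbb{C}$. *)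

(* Defs.v *)
From HB Require Import structures.
From mathcomp Require Import all_boot all_order all_algebra.
From mathcomp Require Import all_classical all_reals all_analysis.
Set Implicit Arguments. Unset Strict Implicit. Unset Printing Implicit Defensive.
Import Order.TTheory GRing.Theory Num.Theory.
Import numFieldNormedType.Exports.
Local Open Scope classical_set_scope.
Local Open Scope ring_scope.

(* The complex plane C is modelled as R * R, w = (Re w, Im w). *)
Section Defs.
Variable R : realType.
Local Notation C := (R * R)%type.

Definition edist (p q : C) : R :=
  Num.sqrt ((p.1 - q.1) ^+ 2 + (p.2 - q.2) ^+ 2).

Definition homeo_halfline (eta : R -> R) : Prop :=
  exists etainv : R -> R,
    [/\ (forall t, 0 <= t -> 0 <= eta t /\ 0 <= etainv t),
        (forall t, 0 <= t -> etainv (eta t) = t /\ eta (etainv t) = t),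
        {within [set t : R | 0 <= t], continuous eta} &
        {within [set t : R | 0 <= t], continuous etainv}].

Definition re_homeo (G : set C) : Prop :=
  [/\ {in G &, injective (fun p : C => p.1)},
      (forall x : R, exists2 p, G p & p.1 = x) &
      (* continuity of the inverse map R -> Gamma *)
      (forall p, G p -> forall e : R, 0 < e -> exists2 d : R, 0 < d &
          forall q, G q -> `|q.1 - p.1| < d -> edist q p < e)].

Definition re_qs_with (G : set C) (eta : R -> R) : Prop :=
  forall a b x, G a -> G b -> G x -> a <> b -> a <> x -> b <> x ->
    `|x.1 - a.1| <= eta (edist x a / edist x b) * `|x.1 - b.1|.

Definition qs_graph (G : set C) : Prop :=
  re_homeo G /\ exists eta, homeo_halfline eta /\ re_qs_with G eta.

Definition s_qs_graph (s : R) (G : set C) : Prop :=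
  re_homeo G /\ exists eta, [/\ homeo_halfline eta, re_qs_with G eta &
     forall t, 0 <= t <= s^-1 -> eta t <= t + s].

Definition dirv (b : bool) : C := if b then (1, 0) else (0, 1).

Definition Dseq (w : seq bool) (phi : C -> R) : C -> R :=
  foldr (fun b g => 'D_(dirv b) g) phi w.

Definition smooth2 (phi : C -> R) : Prop :=
  forall w : seq bool, continuous (Dseq w phi) /\
    forall (b : bool) (p : C), derivable (Dseq w phi) p (dirv b).

Definition test_fun (phi : C -> R) : Prop :=
  smooth2 phi /\ exists r : R, forall p : C, r < edist p 0 -> phi p = 0.

Definition leb2 := (@lebesgue_measure R \x @lebesgue_measure R)%E.

Definition L2loc (g : C -> R) : Prop :=
  measurable_fun setT g /\
  forall r : R, leb2.-integrable [set p | edist p 0 < r] (fun p => ((g p) ^+ 2)%:E).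

Definition weak_partial (b : bool) (u g : C -> R) : Prop :=
  forall phi, test_fun phi ->
    (\int[leb2]_p (u p * 'D_(dirv b) phi p)%:E =
     - \int[leb2]_p (g p * phi p)%:E)%E.

(* f = u + i v is continuous, nonconstant, in W^{1,2}_loc, with weak partials
   ux uy vx vy in L^2_loc, and |f_zbar| <= k Re f_z a.e., where
   f_z    = ((ux + vy) + i (vx - uy)) / 2,
   f_zbar = ((ux - vy) + i (vx + uy)) / 2. *)
Definition reduced_qc_with (k : R) (f : C -> C) : Prop :=
  [/\ 0 <= k < 1, continuous f, (exists p q, f p <> f q) &
    exists ux uy vx vy : C -> R,
      [/\ [/\ L2loc ux, L2loc uy, L2loc vx & L2loc vy],
          [/\ weak_partial true (fun p => (f p).1) ux,
          weak_partial false (fun p => (f p).1) uy,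
          weak_partial true (fun p => (f p).2) vx &
          weak_partial false (fun p => (f p).2) vy] &
          {ae leb2, forall p,
             Num.sqrt ((ux p - vy p) ^+ 2 + (vx p + uy p) ^+ 2) / 2
               <= k * ((ux p + vy p) / 2)}]].

End Defs.

(* Main.v *)
(* Let [G] be the graph of [g] and let [F x = (x, g x)].

   If three points A < M < B of [G] satisfy |M - A| = |M - B|, then
   s-quasisymmetry gives |A + B - 2 M| <= 4 sqrt s Re (B - A): the second
   difference is small relative to the increment of the REAL part, however steep
   the chord is.  Starting from a bi-infinite net with equal chords and repeatedly
   cutting corners (Chaikin's scheme, every Euclidean midpoint being replaced by
   an equidistant point of [G]), second differences stay O(sqrt s) relative to the
   real increments, because corner cutting halves them while rounding to [G]
   adds O(sqrt s).  The limit is a parametrization phi = F o u of [G] with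
   |phi (x + t) + phi (x - t) - 2 phi x| <= c Re (phi (x + t) - phi (x - t)),
   c = O(sqrt s), for t below the initial mesh; coarser and coarser initial nets
   and an ultrafilter limit remove the restriction on t.

   The Beurling-Ahlfors type extension
     f (x, y) = (a (x, y) + a (x, -y)) / 2 + i (a (x, y) - a (x, -y)),
   a (x, y) the mean of phi between x and x + y, is then C^1 off the real line,
   and there fzbar is controlled by second differences and Re fz by real
   increments of phi.  The condition on phi also gives |Df| <= C (4/3)^n where
   |y| is about 2^-n, whence f is in W^{1,2}_loc. *)
Require Import Defs.
From HB Require Import structures.
From mathcomp Require Import all_boot all_order all_algebra.
From mathcomp Require Import all_classical all_reals all_analysis.
From mathcomp Require Import measurable_realfun ring lra zify.
Set Implicit Arguments.
Unset Strict Implicit.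
Unset Printing Implicit Defensive.
Import Order.TTheory GRing.Theory Num.Theory.
Import numFieldNormedType.Exports.
Local Open Scope classical_set_scope.
Local Open Scope ring_scope.

(** * Equidistant points on a quasisymmetric graph *)

(** Bisection could not replace corner cutting: at a point that is kept it halves the second
    difference and the real increments alike, so their ratio survives and collects a new error of
    order sqrt s in every generation. Cutting corners divides second differences by four and
    increments by two, so the ratio stays bounded. The bound has to be relative to the real
    increment and not to the chord, because Re fz must dominate |fzbar| and Re fz sees only
    increments of Re phi. The estimates are therefore made for a set of real functions applied to
    one net of abscissas, later [id] and [g]: scales are measured with [id], errors with both. The
    weights 1/2 and 1 in the extension are those that extend phi (x) = x to the identity, as then a
    (x, y) = x + y / 2. For general phi they cancel the first-order terms of fzbar and leave second
    differences. *)

Lemma re_homeo_graph (R : realType) (G : set (R * R)) : re_homeo G ->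
  exists2 g : R -> R, continuous g & G = [set p | p.2 = g p.1].
Proof.
move=> [inj surj cont].
have /choice[g Hg] : forall x : R, exists y, G (x, y).
  by move=> x; have [[a b] Gp /= <-] := surj x; exists b.
exists g.
- move=> x; apply/cvgrPdist_lt => e e0.
  have [d d0 Hd] := cont _ (Hg x) _ e0.
  near=> y.
  have /(Hd _ (Hg y)) : `|(y, g y).1 - (x, g x).1| < d.
    by rewrite /= distrC; near: y; exact: cvgr_dist_lt.
  apply: le_lt_trans.
  rewrite /Defs.edist /= distrC -sqrtr_sqr ler_sqrt ?lerDr ?sqr_ge0//.
  by rewrite addr_ge0 ?sqr_ge0.
- apply/seteqP; split => -[x y] /=; last by move=> ->; exact: Hg.
  move=> Gxy; have := inj (x, y) (x, g x); rewrite !inE.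
  by move=> /(_ Gxy (Hg x) erefl)[].
Unshelve. all: by end_near. Qed.

Lemma edist_sqr (R : realType) (p q : R * R) :
  Defs.edist p q ^+ 2 = (p.1 - q.1) ^+ 2 + (p.2 - q.2) ^+ 2.
Proof. by rewrite sqr_sqrtr// addr_ge0// sqr_ge0. Qed.

Lemma edist_ge0 (R : realType) (p q : R * R) : 0 <= Defs.edist p q.
Proof. exact: sqrtr_ge0. Qed.

Lemma edistC (R : realType) (p q : R * R) : Defs.edist p q = Defs.edist q p.
Proof. by rewrite /Defs.edist -sqrrN opprB -[(p.2 - _) ^+ 2]sqrrN opprB. Qed.

Lemma edist_gt0 (R : realType) (p q : R * R) : p.1 != q.1 -> 0 < Defs.edist p q.
Proof.
move=> pq; rewrite sqrtr_gt0 ltr_pwDl// ?sqr_ge0//.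
by rewrite lt_neqAle sqr_ge0 andbT eq_sym sqrf_eq0 subr_eq0.
Qed.

(* The vector [W = A + B - 2M] is orthogonal to [V = B - A], and
   quasisymmetry at [M] bounds [W.1].  On steep chords orthogonality
   turns this into a bound on [W.2]; otherwise quasisymmetry at [A] shows
   that [M] almost halves the chord, so that [|W|^2 = 4 |M - A|^2 - |V|^2] is
   small. *)
Lemma equidistant_midpoint (R : realType) (s : R) (G : set (R * R)) A B M :
    0 < s <= 4^-1 -> s_qs_graph s G -> G A -> G B -> G M ->
    A.1 < M.1 -> M.1 < B.1 -> Defs.edist M A = Defs.edist M B ->
  `|A.1 + B.1 - 2 * M.1| <= 4 * Num.sqrt s * (B.1 - A.1) /\
  `|A.2 + B.2 - 2 * M.2| <= 4 * Num.sqrt s * (B.1 - A.1).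
Proof.
move=> /andP[s0 s4] [_ [eta [_ qs Heta]]] GA GB GM AM MB eqd.
have AB : A.1 < B.1 by exact: lt_trans MB.
have sinv : 4 <= s^-1 by rewrite -[4]invrK lef_pV2 ?posrE// invr_gt0.
have nAB : A <> B by move=> E; rewrite E ltxx in AB.
have nAM : A <> M by move=> E; rewrite E ltxx in AM.
have nBM : B <> M by move=> E; rewrite E ltxx in MB.
have d0 : 0 < Defs.edist M A by rewrite edist_gt0// gt_eqF.
have dn : Defs.edist M A != 0 by rewrite gt_eqF.
have ss : Num.sqrt s ^+ 2 = s by rewrite sqr_sqrtr// ltW.
have sq0 : 0 < Num.sqrt s by rewrite sqrtr_gt0.
(* Since [s^-1 >= 4], the ratios 1 and, for a flat chord, [l / d <= 2] lie in the range where
   [eta t <= t + s]. *)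
have eta1 : eta 1 <= 1 + s by apply: Heta; rewrite ler01/=; lra.
have h1 : M.1 - A.1 <= (1 + s) * (B.1 - M.1).
  have := qs A B M GA GB GM nAB nAM nBM.
  rewrite -eqd divff// ger0_norm; last lra.
  rewrite distrC ger0_norm; last lra.
  by move=> /le_trans; apply; apply: ler_wpM2r => //; lra.
have h2 : B.1 - M.1 <= (1 + s) * (M.1 - A.1).
  have := qs B A M GB GA GM (not_eq_sym nAB) nBM nAM.
  rewrite eqd divff -?eqd// distrC ger0_norm; last lra.
  rewrite ger0_norm; last lra.
  by move=> /le_trans; apply; apply: ler_wpM2r => //; lra.
have eA := edist_sqr M A; have eB := edist_sqr M B.
rewrite -eqd in eB.
have eV := edist_sqr A B.
have lV0 := edist_ge0 A B.
set d := Defs.edist M A in eqd d0 dn eA eB; set l := Defs.edist A B in eV lV0.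
set t := Num.sqrt s in ss sq0 *.
have t2 : t <= 2^-1.
  rewrite -(@ler_pXn2r _ 2)// ?nnegrE ?(ltW sq0) ?invr_ge0// ss.
  by have -> : 2^-1 ^+ 2 = 4^-1 :> R by field.
have orth : (B.1 - A.1) * (A.1 + B.1 - 2 * M.1) +
    (B.2 - A.2) * (A.2 + B.2 - 2 * M.2) = 0 by nra.
set V1 := B.1 - A.1 in orth *; set V2 := B.2 - A.2 in orth *.
set W1 := A.1 + B.1 - 2 * M.1 in orth *; set W2 := A.2 + B.2 - 2 * M.2 in orth *.
have V10 : 0 < V1 by rewrite /V1; lra.
have W1s : `|W1| <= s * V1.
  rewrite ler_norml; apply/andP; rewrite /W1 /V1; split; nra.
have st : s <= t by rewrite -ss; nra.
have W1t : `|W1| <= t * V1.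
  by apply: le_trans W1s _; rewrite ler_wpM2r// ltW.
split; first by apply: le_trans W1t _; rewrite ler_wpM2r ?ltW//; lra.
have [steep|flat] := leP V1 `|V2|.
  have V20 : 0 < `|V2| by exact: lt_le_trans steep.
  have : `|V2| * `|W2| = V1 * `|W1|.
    rewrite -normrM -[in RHS](gtr0_norm V10) -normrM -normrN; congr `|_|.
    by apply/eqP; rewrite -subr_eq0; apply/eqP; lra.
  move=> E; suff : `|W2| <= `|W1| by nra.
  rewrite -(ler_pM2l V20) E ler_wpM2r//.
have l2 : l ^+ 2 = V1 ^+ 2 + V2 ^+ 2 by rewrite eV /V1 /V2; ring.
have V2l : V2 ^+ 2 <= V1 ^+ 2.
  by rewrite -[V2 ^+ 2]real_normK ?num_real//; rewrite ler_pXn2r ?nnegrE// ltW.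
have lV : l <= 2 * V1 by rewrite -(@ler_pXn2r _ 2)// ?nnegrE; nra.
have pyth : W1 ^+ 2 + W2 ^+ 2 = 4 * d ^+ 2 - l ^+ 2.
  rewrite l2 /W1 /W2 /V1 /V2; nra.
have ld : l <= 2 * d.
  by rewrite -(@ler_pXn2r _ 2)// ?nnegrE; nra.
have h3 : V1 <= (l / d + s) * (M.1 - A.1).
  have := qs B M A GB GM GA (nBM) (not_eq_sym nAB) (not_eq_sym nAM).
  rewrite -/l [Defs.edist A M]edistC -/d distrC ger0_norm; last lra.
  rewrite distrC ger0_norm; last lra.
  move=> /le_trans; apply; apply: ler_wpM2r; first lra.
  apply: Heta; rewrite divr_ge0 ?(ltW d0)//= ler_pdivrMr//.
  by apply: le_trans ld _; rewrite ler_wpM2r ?ltW//; lra.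
(* [h1] gives [V1 >= (2 - s) (M.1 - A.1)]; inserted in [h3] this forces [l / d + s >= 2 - s]. *)
have r1 : 2 - 2 * s <= l / d.
  have p0 : 0 < M.1 - A.1 by lra.
  rewrite -(ler_pM2r p0); rewrite /V1 in h3.
  set r := l / d in h3 *; nra.
have r2 : (2 - 2 * s) * d <= l by rewrite -ler_pdivlMr.
(* Origin of the factor 4: [4 d^2 - l^2 <= 8 s d^2 <= 8 s l^2 <= 16 s V1^2], where the last step
   uses [l^2 <= 2 V1^2] for a flat chord. *)
have : W2 ^+ 2 <= (4 * t * V1) ^+ 2.
  have : (2 - 2 * s) ^+ 2 * d ^+ 2 <= l ^+ 2.
    by rewrite -exprMn ler_pXn2r// ?nnegrE// mulr_ge0//; lra.
  have : l ^+ 2 <= 2 * V1 ^+ 2 by lra.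
  have : 0 <= W1 ^+ 2 by exact: sqr_ge0.
  rewrite 2!exprMn ss.
  move: pyth; set d2 := d ^+ 2; set ll := l ^+ 2; set w1 := W1 ^+ 2; set w2 := W2 ^+ 2.
  set v := V1 ^+ 2 => pyth w10 lv dl.
  have d20 : 0 <= d2 by exact: sqr_ge0.
  have k1 : w2 <= 4 * d2 - ll by lra.
  have k2 : 4 * d2 - ll <= 8 * s * d2 by nra.
  have k3 : d2 <= ll by nra.
  nra.
rewrite -[W2 ^+ 2]real_normK ?num_real// ler_pXn2r// nnegrE//.
by rewrite !mulr_ge0// ?ltW.
Qed.

Section SecondDifferences.
Context {R : realType} (s : R) (g : R -> R).
Hypotheses (s04 : 0 < s <= 4^-1) (cg : continuous g).
Hypothesis qs : s_qs_graph s [set p : R * R | p.2 = g p.1].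

Let sqd (a x : R) := (x - a) ^+ 2 + (g x - g a) ^+ 2.

Let cont_sqd a : continuous (sqd a).
Proof.
move=> x; apply: cvgD; apply: (@cvg_comp _ _ _ _ (fun y => y ^+ 2) _ (nbhs _)).
- by apply: cvgB; [exact: cvg_id|exact: cvg_cst].
- exact: exprn_continuous.
- by apply: cvgB; [exact: cg|exact: cvg_cst].
- exact: exprn_continuous.
Qed.

Let edist_sqd a b x y : sqd a x = sqd b y ->
  Defs.edist (x, g x) (a, g a) = Defs.edist (y, g y) (b, g b).
Proof. by rewrite /sqd /Defs.edist /= => ->. Qed.

Let sqd_gt0 a x : x != a -> 0 < sqd a x.
Proof.
move=> xa; rewrite ltr_pwDl ?sqr_ge0//.
by rewrite lt_neqAle sqr_ge0 andbT eq_sym sqrf_eq0 subr_eq0.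
Qed.

(** The difference of the squared distances to the two ends changes sign on [[a, b]], and a zero of
    it is an equidistant point. *)
Lemma graph_midpoint a b : a < b -> exists m, 
  [/\ a < m < b, `|a + b - 2 * m| <= 10 * Num.sqrt s * (b - a) &
      `|g a + g b - 2 * g m| <= 10 * Num.sqrt s * (b - a)].
Proof.
move=> ab.
have [|| m] := @IVT R (fun x => sqd a x - sqd b x) a b 0 (ltW ab).
- apply: continuous_subspaceT => x; apply: cvgB; exact: cont_sqd.
- rewrite /sqd !subrr expr0n/= addr0 sub0r subr0 ge_min le_max.
  by rewrite oppr_le0 !addr_ge0 ?sqr_ge0 ?orbT.
rewrite in_itv/= => /andP[am mb] /eqP; rewrite subr_eq0 => /eqP E.
have am' : a < m.
  rewrite lt_neqAle am andbT; apply/eqP => am'; subst m.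
  have := @sqd_gt0 b a; rewrite -E /sqd !subrr expr0n/= addr0 ltxx.
  by move=> /(_ _)/negP; rewrite lt_eqF// => /(_ isT).
have mb' : m < b.
  rewrite lt_neqAle mb andbT; apply/eqP => mb'; subst m.
  have := @sqd_gt0 a b; rewrite E /sqd !subrr expr0n/= addr0 ltxx.
  by move=> /(_ _)/negP; rewrite gt_eqF// => /(_ isT).
exists m; rewrite am' mb'.
have [h1 h2] := @equidistant_midpoint R s _ (a, g a) (b, g b) (m, g m) s04 qs
  erefl erefl erefl am' mb' (edist_sqd E).
have := sqrtr_ge0 s.
by split => //; [apply: le_trans h1 _|apply: le_trans h2 _] => /=; nra.
Qed.

(** Equal chords have ratio 1 and [eta 1 <= 1 + s <= 2], so their real parts differ at most by a
    factor 2. *)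
Let qs_ratio a b c : a < b -> b < c -> sqd b a = sqd b c ->
  [/\ c - b <= 2 * (b - a), b - a <= 2 * (c - b),
      `|a + c - 2 * b| <= 4 * Num.sqrt s * (c - a) &
      `|g a + g c - 2 * g b| <= 4 * Num.sqrt s * (c - a)].
Proof.
move=> ab bc E.
have eqd : Defs.edist (b, g b) (a, g a) = Defs.edist (b, g b) (c, g c).
  by rewrite edistC [RHS]edistC; exact: edist_sqd.
have [h1 h2] := @equidistant_midpoint R s _ (a, g a) (c, g c) (b, g b) s04 qs
  erefl erefl erefl ab bc eqd.
case: qs => _ [eta [_ Q H]].
case/andP: s04 => s0 s4.
have sinv : 4 <= s^-1 by rewrite -[4]invrK lef_pV2 ?posrE// invr_gt0.
have eta1 : eta 1 <= 2.
  by apply: le_trans (H 1 _) _; [rewrite ler01/=; lra|lra].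
have nac : (a, g a) <> (c, g c) by case=> ac _; lra.
have nab : (a, g a) <> (b, g b) by case=> ac _; lra.
have ncb : (c, g c) <> (b, g b) by case=> ac _; lra.
have d0 : Defs.edist (b, g b) (a, g a) != 0.
  by rewrite gt_eqF// edist_gt0//= gt_eqF.
split => //.
- have := Q (c, g c) (a, g a) (b, g b) erefl erefl erefl (not_eq_sym nac) ncb nab.
  rewrite -eqd divff//= distrC ger0_norm ?ger0_norm; [|lra..].
  by move=> /le_trans; apply; rewrite ler_wpM2r//; lra.
- have := Q (a, g a) (c, g c) (b, g b) erefl erefl erefl nac nab ncb.
  rewrite -eqd divff//= [`|b - c|]distrC ger0_norm ?ger0_norm; [|lra..].
  by move=> /le_trans; apply; rewrite ler_wpM2r//; lra.
Qed.

(** By [qs_ratio], [c - a <= 3 (b - a)]; this turns the factor 4 of [equidistant_midpoint] into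
    12. *)
Lemma graph_reflect_right a b : a < b -> exists c,
  [/\ b < c, `|a + c - 2 * b| <= 12 * Num.sqrt s * (b - a) &
      `|g a + g c - 2 * g b| <= 12 * Num.sqrt s * (b - a)].
Proof.
move=> ab; pose L := sqd b a.
have L0 : 0 < L by apply: sqd_gt0; rewrite lt_eqF.
(* At horizontal distance [1 + L] the squared distance is at least [(1 + L)^2 > L], so the interval
   is long enough. *)
have [||| c] := @IVT R (sqd b) b (b + (1 + L)) L; first lra.
- by apply: continuous_subspaceT; exact: cont_sqd.
- rewrite ge_min le_max {1}/sqd !subrr expr0n/= addr0 (ltW L0)/=.
  apply/orP; right; rewrite /sqd addrAC subrr add0r.
  have := sqr_ge0 (g (b + (1 + L)) - g b).
  rewrite expr2; nra.
rewrite in_itv/= => /andP[bc _] E.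
have bc' : b < c.
  rewrite lt_neqAle bc andbT; apply/eqP => bc'; subst c.
  by move: L0; rewrite -E /sqd !subrr expr0n/= addr0 ltxx.
exists c; have [h1 h2 h3 h4] := qs_ratio ab bc' (esym E).
have := sqrtr_ge0 s.
by split => //; [apply: le_trans h3 _|apply: le_trans h4 _]; nra.
Qed.

Lemma graph_reflect_left a b : a < b -> exists c,
  [/\ c < a, `|c + b - 2 * a| <= 12 * Num.sqrt s * (b - a) &
      `|g c + g b - 2 * g a| <= 12 * Num.sqrt s * (b - a)].
Proof.
move=> ab; pose L := sqd a b.
have L0 : 0 < L by apply: sqd_gt0; rewrite gt_eqF.
have [||| c] := @IVT R (sqd a) (a - (1 + L)) a L; first lra.
- by apply: continuous_subspaceT; exact: cont_sqd.
- rewrite ge_min le_max {2}/sqd !subrr expr0n/= addr0 (ltW L0)/= orbT /=.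
  apply/orP; left; rewrite /sqd addrAC subrr add0r.
  have := sqr_ge0 (g (a - (1 + L)) - g a).
  rewrite expr2; nra.
rewrite in_itv/= => /andP[_ ca] E.
have ca' : c < a.
  rewrite lt_neqAle ca andbT; apply/eqP => ca'; subst c.
  by move: L0; rewrite -E /sqd !subrr expr0n/= addr0 ltxx.
exists c; have [h1 h2 h3 h4] := qs_ratio ca' ab E.
have := sqrtr_ge0 s.
by split => //; [apply: le_trans h3 _|apply: le_trans h4 _]; nra.
Qed.

End SecondDifferences.

(** * Corner cutting on the graph *)

Lemma int_parity (i : int) : exists j : int, i = 2 * j \/ i = 2 * j + 1.
Proof.
exists (i %/ 2)%Z; have := divz_eq i 2; rewrite mulrC.
have : (0 <= i %% 2)%Z && ((i %% 2)%Z < 2) by rewrite modz_ge0//= ltz_pmod.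
case: (i %% 2)%Z => //= -[|[|//]] _ E; last by right; exact: E.
by left; rewrite {1}E addr0.
Qed.

Lemma odd_succ (j : int) : 2 * j + 1 + 1 = 2 * (j + 1).
Proof. lia. Qed.

Lemma int_between (i j : int) : i < 2 * j + 2 -> 2 * j < i + 1 ->
  i = 2 * j \/ i = 2 * j + 1.
Proof. lia. Qed.

Lemma int_near (i j : int) : i < j + 2 -> j < i + 2 ->
  [\/ i = j, i = j + 1 | j = i + 1].
Proof.
move=> h1 h2; have : i = j \/ i = j + 1 \/ j = i + 1 by lia.
by case=> [|[]]; [constructor 1|constructor 2|constructor 3].
Qed.

Lemma PoszD12 (n : nat) : n%:Z + 1 = n.+1%:Z /\ n%:Z + 2 = n.+2%:Z.
Proof. by split; lia. Qed.

Lemma NegzD12 (n : nat) : Negz n.+2 + 1 = Negz n.+1 /\ Negz n.+2 + 2 = Negz n.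
Proof. by split; lia. Qed.

Section CornerCutting.
Context {R : realType}.
Implicit Types A B C k h : R.

(** [q] and [r] are Chaikin's points at one and three quarters of the cell. Rounding the midpoint
    costs [k / 2], of which half reaches [q]; rounding [q] itself costs another [k / 2]. *)
Lemma corner_bounds A B m q r k : `|A + B - 2 * m| <= k ->
    `|A + m - 2 * q| <= k -> `|m + B - 2 * r| <= k ->
  `|q - (3 * A + B) / 4| <= k /\ `|r - (A + 3 * B) / 4| <= k.
Proof.
rewrite !ler_norml => /andP[? ?] /andP[? ?] /andP[? ?].
by split; apply/andP; split; lra.
Qed.

Lemma corner_width A B q r k h : h = B - A -> 0 <= h -> k <= 1000^-1 * h ->
    `|q - (3 * A + B) / 4| <= k -> `|r - (A + 3 * B) / 4| <= k ->
  49 / 100 * h <= r - q <= 7 / 10 * h.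
Proof.
rewrite !ler_norml => -> ? ? /andP[? ?] /andP[? ?].
by apply/andP; split; lra.
Qed.

(** The new cell straddles [B]. Up to rounding its width is [(C - A) / 4], which is half of either
    old width up to a quarter of the second difference, and that difference is at most 40/1000 of
    each width. *)
Lemma corner_width_across A B C q r k h k' h' : h = B - A -> h' = C - B ->
    k <= 1000^-1 * h -> k' <= 1000^-1 * h' ->
    `|A + C - 2 * B| <= 40 * k -> `|A + C - 2 * B| <= 40 * k' ->
    `|r - (A + 3 * B) / 4| <= k -> `|q - (3 * B + C) / 4| <= k' ->
  [/\ 48 / 100 * h <= q - r, q - r <= 7 / 10 * h & 48 / 100 * h' <= q - r].
Proof.
rewrite !ler_norml => -> -> ? ? /andP[? ?] /andP[? ?] /andP[? ?] /andP[? ?].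
by split; lra.
Qed.

Lemma neighbour_width A B C k h k' h' : h = B - A -> h' = C - B ->
    k <= 1000^-1 * h -> k' <= 1000^-1 * h' ->
    `|A + C - 2 * B| <= 40 * k -> `|A + C - 2 * B| <= 40 * k' ->
  h <= 2 * h' /\ h' <= 2 * h.
Proof.
by rewrite !ler_norml => -> -> ? ? /andP[? ?] /andP[? ?]; split; lra.
Qed.

(** Chaikin's mask divides the second difference by 4: the bound is 40/4 plus 2, 1 and 2 for
    rounding [r], [r'] and [q'], in all 15. New widths are at least 48/100 of the old ones, and 15 /
    0.48 < 40 makes the constant 40 reproduce itself. *)
Lemma corner_second_diff_right A B C r q' r' k k' : `|A + C - 2 * B| <= 40 * k' ->
    `|r - (A + 3 * B) / 4| <= k -> `|q' - (3 * B + C) / 4| <= k' ->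
    `|r' - (B + 3 * C) / 4| <= k' -> k <= 2 * k' ->
  `|r + r' - 2 * q'| <= 15 * k'.
Proof.
rewrite !ler_norml => /andP[? ?] /andP[? ?] /andP[? ?] /andP[? ?] ?.
by apply/andP; split; lra.
Qed.

Lemma corner_second_diff_left A B C q r q' k k' : `|A + C - 2 * B| <= 40 * k ->
    `|q - (3 * A + B) / 4| <= k -> `|r - (A + 3 * B) / 4| <= k ->
    `|q' - (3 * B + C) / 4| <= k' -> k' <= 2 * k ->
  `|q + q' - 2 * r| <= 15 * k.
Proof.
rewrite !ler_norml => /andP[? ?] /andP[? ?] /andP[? ?] /andP[? ?] ?.
by apply/andP; split; lra.
Qed.

Lemma corner_slope A B q r k : 
    `|q - (3 * A + B) / 4| <= k -> `|r - (A + 3 * B) / 4| <= k ->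
  `|r - q - (B - A) / 2| <= 13 * k.
Proof.
move=> h1 h2; have k0 := le_trans (normr_ge0 _) h1; move: h1 h2.
rewrite !ler_norml => /andP[? ?] /andP[? ?].
by apply/andP; split; lra.
Qed.

(** The left side is a quarter of the second difference up to rounding, and 13 = 10 + 1 + 2.
    [corner_slope] states the same constant so that both parities of cells share one bound. *)
Lemma corner_slope_across A B C r q' k k' : `|A + C - 2 * B| <= 40 * k ->
    `|r - (A + 3 * B) / 4| <= k -> `|q' - (3 * B + C) / 4| <= k' -> k' <= 2 * k ->
  `|q' - r - (B - A) / 2| <= 13 * k.
Proof.
rewrite !ler_norml => /andP[? ?] /andP[? ?] /andP[? ?] ?.
by apply/andP; split; lra.
Qed.

Lemma affine_error (X Y y k : R) : `|X| <= k -> `|Y| <= 13 * k ->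
  `|y| <= 3 -> `|X + Y * y| <= 60 * k.
Proof.
move=> hX hY hy; apply: le_trans (ler_normD _ _) _; rewrite normrM.
have := ler_pM (normr_ge0 _) (normr_ge0 _) hY hy.
have := le_trans (normr_ge0 X) hX; lra.
Qed.

Lemma neighbour_error (X y k : R) : `|X| <= 40 * k -> `|y| <= 3 / 2 ->
  `|X * y| <= 60 * k.
Proof.
move=> hX hy; rewrite normrM.
have := ler_pM (normr_ge0 _) (normr_ge0 _) hX hy; lra.
Qed.

Lemma width_scale (k x : R) : 0 <= k -> 48 / 100 * k <= x -> 15 * k <= 40 * x.
Proof. lra. Qed.

Lemma width_scale' (k x : R) : 0 <= k -> 49 / 100 * k <= x -> 15 * k <= 40 * x.
Proof. lra. Qed.

Lemma initial_balance (a b c k k' : R) : k <= 1000^-1 * (b - a) ->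
    k' <= 1000^-1 * (c - b) -> a < b -> b < c ->
    `|a + c - 2 * b| <= k \/ `|a + c - 2 * b| <= k' ->
  b - a <= 2 * (c - b) /\ c - b <= 2 * (b - a).
Proof.
by move=> ? ? ? ?; rewrite !ler_norml => -[/andP[? ?]|/andP[? ?]]; split; lra.
Qed.

End CornerCutting.

Section Nets.
Context {R : realType} (e : R) (W : set (R -> R)).
Variables (mid rright rleft : R -> R -> R).
Hypotheses (e01 : 0 <= e <= 1000^-1) (idW : W id).
Hypothesis midP : forall a b, a < b -> a < mid a b < b /\
  forall w, W w -> `|w a + w b - 2 * w (mid a b)| <= e * (b - a).
Hypothesis rrightP : forall a b, a < b -> b < rright a b /\
  forall w, W w -> `|w a + w (rright a b) - 2 * w b| <= e * (b - a).
Hypothesis rleftP : forall a b, a < b -> rleft a b < a /\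
  forall w, W w -> `|w (rleft a b) + w b - 2 * w a| <= e * (b - a).

(** One step of Chaikin's scheme: cell [j] yields the points near one quarter (index [2 j]) and
    three quarters (index [2 j + 1]), and the old points are dropped. *)
Definition net_step (p : int -> R) (i : int) : R :=
  let j := (i %/ 2)%Z in let m := mid (p j) (p (j + 1)) in
  if (i %% 2)%Z == 0 then mid (p j) m else mid m (p (j + 1)).

Lemma net_step_even p j :
  net_step p (2 * j) = mid (p j) (mid (p j) (p (j + 1))).
Proof. by rewrite /net_step modzMr eqxx mulKz. Qed.

Lemma net_step_odd p j :
  net_step p (2 * j + 1) = mid (mid (p j) (p (j + 1))) (p (j + 1)).
Proof.
rewrite /net_step mulrC modzMDl divzMDl//.
by rewrite (_ : (1 %% 2)%Z = 1)// (_ : (1 %/ 2)%Z = 0)// addr0.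
Qed.

(** Both neighbouring widths serve as scale because the new cell across [b] must be compared with
    either of them. Applied to [id], the two bounds also make neighbouring widths comparable. *)
Definition balanced3 a b c := [/\ a < b, b < c & forall w, W w ->
  `|w a + w c - 2 * w b| <= 40 * (e * (b - a)) /\
  `|w a + w c - 2 * w b| <= 40 * (e * (c - b))].

Let e0 : 0 <= e. Proof. by case/andP: e01. Qed.

Let width_ge0 (a b : R) : a < b -> 0 <= b - a.
Proof. by move=> ab; rewrite subr_ge0 ltW. Qed.

Let ek a b : a < b -> e * (b - a) <= 1000^-1 * (b - a).
Proof. by move=> ab; rewrite ler_wpM2r ?subr_ge0 ?(ltW ab)//; case/andP: e01. Qed.

Lemma corner a b : a < b ->
  let m := mid a b in let q := mid a m in let r := mid m b in
  [/\ a < q, q < r, r < b & forall w, W w ->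
     `|w q - (3 * w a + w b) / 4| <= e * (b - a) /\
     `|w r - (w a + 3 * w b) / 4| <= e * (b - a)].
Proof.
move=> ab m q r; have [/andP[am mb] Hm] := midP ab; rewrite -/m in am mb Hm.
have [/andP[aq qm] Hq] := midP am; have [/andP[mr rb] Hr] := midP mb.
split => //; first exact: lt_trans qm mr.
move=> w Ww; apply: corner_bounds (Hm _ Ww) _ _.
- by apply: le_trans (Hq _ Ww) _; rewrite ler_wpM2l// lerD2r ltW.
- by apply: le_trans (Hr _ Ww) _; rewrite ler_wpM2l// lerD2l lerN2 ltW.
Qed.

Lemma balanced3_width a b c : balanced3 a b c ->
  b - a <= 2 * (c - b) /\ c - b <= 2 * (b - a).
Proof.
move=> [ab bc H]; have [h1 h2] := H _ idW.
exact: neighbour_width erefl erefl (ek ab) (ek bc) h1 h2.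
Qed.

Let balanced3_k a b c : balanced3 a b c ->
  e * (b - a) <= 2 * (e * (c - b)) /\ e * (c - b) <= 2 * (e * (b - a)).
Proof.
move=> /balanced3_width[h1 h2].
by rewrite mulrCA ler_wpM2l// mulrCA ler_wpM2l.
Qed.

Definition balanced (p : int -> R) :=
  forall j, balanced3 (p j) (p (j + 1)) (p (j + 2)).

Lemma net_step_balanced p : balanced p -> balanced (net_step p).
Proof.
move=> Hp i; have [j [->|->]] := int_parity i.
  rewrite (_ : 2 * j + 2 = 2 * (j + 1)); last by lia.
  rewrite !net_step_even net_step_odd.
  rewrite -[j + 1 + 1]addrA (_ : 1 + 1 = 2)//.
  have [_ kb] := balanced3_k (Hp j).
  have [ab bc H] := Hp j; have [aq qr rb H1] := corner ab.
  have [bq' qr' rc' H2] := corner bc.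
  have [h1 h2] := H _ idW.
  have [h3 h4] := H1 _ idW; have [h5 h6] := H2 _ idW.
  have [w1 _ _] := corner_width_across erefl erefl (ek ab) (ek bc) h1 h2 h4 h5.
  have /andP[w2 _] := corner_width erefl (width_ge0 ab) (ek ab) h3 h4.
  split; [exact: qr|exact: lt_trans rb bq'|].
  move=> w Ww; have [{}h1 {}h2] := H _ Ww.
  have [{}h3 {}h4] := H1 _ Ww; have [{}h5 {}h6] := H2 _ Ww.
  have /le_trans K := corner_second_diff_left h1 h3 h4 h5 kb.
  have g1 := ler_wpM2l e0 w1; have g2 := ler_wpM2l e0 w2.
  have g3 : 0 <= e * (p (j + 1) - p j) by rewrite mulr_ge0// subr_ge0 ltW.
  rewrite mulrCA in g1; rewrite mulrCA in g2.
  by split; apply: K; [exact: width_scale'|exact: width_scale].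
rewrite -!addrA (_ : 1 + 1 = 2 * 1)// (_ : 1 + 2 = 2 * 1 + 1)//.
rewrite addrA -!mulrDr !net_step_odd net_step_even.
rewrite -[j + 1 + 1]addrA (_ : 1 + 1 = 2)//.
have [kb _] := balanced3_k (Hp j).
have [ab bc H] := Hp j; have [aq qr rb H1] := corner ab.
have [bq' qr' rc' H2] := corner bc.
have [h1 h2] := H _ idW.
have [h3 h4] := H1 _ idW; have [h5 h6] := H2 _ idW.
have [_ _ w1] := corner_width_across erefl erefl (ek ab) (ek bc) h1 h2 h4 h5.
have /andP[w2 _] := corner_width erefl (width_ge0 bc) (ek bc) h5 h6.
split; [exact: lt_trans rb bq'|exact: qr'|].
move=> w Ww; have [{}h1 {}h2] := H _ Ww.
have [{}h3 {}h4] := H1 _ Ww; have [{}h5 {}h6] := H2 _ Ww.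
have /le_trans K := corner_second_diff_right h2 h4 h5 h6 kb.
have g1 := ler_wpM2l e0 w1; have g2 := ler_wpM2l e0 w2.
have g3 : 0 <= e * (p (j + 2) - p (j + 1)) by rewrite mulr_ge0// subr_ge0 ltW.
rewrite mulrCA in g1; rewrite mulrCA in g2.
by split; apply: K; [exact: width_scale|exact: width_scale'].
Qed.

(* Affine extrapolation from the cell [j]; the offset 1/2 makes it commute, up
   to [O(e)], with the corner cutting [net_step] and doubling of [z]. *)
Definition cell_affine (w : R -> R) (p : int -> R) (j : int) (z : R) : R :=
  w (p j) + (z - j%:~R + 2^-1) * (w (p (j + 1)) - w (p j)).

Lemma net_step_cell p j z i : balanced p -> j%:~R <= z < j%:~R + 1 ->
    i%:~R <= 2 * z < i%:~R + 1 ->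
  let h := p (j + 1) - p j in let p' := net_step p in
  p' (i + 1) - p' i <= 7 / 10 * h /\ forall w, W w ->
  `|cell_affine w p' i (2 * z) - cell_affine w p j z| <= 60 * (e * h) /\
  `|w (p' (i + 1)) - w (p' i)| <=
    2^-1 * `|w (p (j + 1)) - w (p j)| + 13 * (e * h).
Proof.
move=> Hp /andP[jz zj] /andP[iz zi] h p'.
have E : i = 2 * j \/ i = 2 * j + 1.
  have k1 : i < 2 * j + 2.
    by rewrite -(ltr_int R) intrD intrM; apply: le_lt_trans iz _; lra.
  have k2 : 2 * j < i + 1.
    by rewrite -(ltr_int R) intrD intrM; apply: le_lt_trans zi; lra.
  exact: int_between.
have slope_norm (X Y k : R) : `|X - Y / 2| <= 13 * k ->
    `|X| <= 2^-1 * `|Y| + 13 * k.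
  move=> XY; rewrite -[X in `|X| <= _](subrK (Y / 2)).
  apply: le_trans (ler_normD _ _) _; rewrite addrC lerD//.
  by rewrite normrM [`|2^-1|]ger0_norm ?invr_ge0// mulrC.
have [y Ey] : exists y, z = j%:~R + y by exists (z - j%:~R); rewrite addrC subrK.
have {jz zj}[y0 y1] : 0 <= y /\ y < 1 by rewrite Ey in jz zj; lra.
have Hy : `|2 * y + 2^-1| <= 3 by rewrite ler_norml; apply/andP; split; lra.
have Hy' : `|2 * y - 2^-1| <= 3 by rewrite ler_norml; apply/andP; split; lra.
have [_ kb] := balanced3_k (Hp j).
have [ab bc H] := Hp j; have [aq qr rb H1] := corner ab.
have [bq' qr' rc' H2] := corner bc.
have [h1 h2] := H _ idW.
have [h3 h4] := H1 _ idW; have [h5 h6] := H2 _ idW.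
case: E => Ei; subst i.
- have /andP[_ w1] := corner_width erefl (width_ge0 ab) (ek ab) h3 h4.
  rewrite /cell_affine /p' net_step_even net_step_odd; split; first exact: w1.
  move=> w Ww; have [{}h3 {}h4] := H1 _ Ww; split; last first.
    exact/slope_norm/corner_slope.
  have D := corner_slope h3 h4.
  set q := w (mid _ _) in h3 D *; set r := w (mid _ _) in h4 D *.
  set A := w (p j) in h3 h4 D *; set B := w (p (j + 1)) in h3 h4 D *.
  rewrite (_ : _ - _ = (q - (3 * A + B) / 4) +
     (r - q - (B - A) / 2) * (2 * y + 2^-1)); last first.
    by rewrite Ey intrM; field.
  exact: affine_error.
have [_ w1 _] := corner_width_across erefl erefl (ek ab) (ek bc) h1 h2 h4 h5.
rewrite /cell_affine odd_succ.
rewrite /p' net_step_even net_step_odd.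
rewrite -[j + 1 + 1]addrA (_ : 1 + 1 = 2)//.
split; first exact: w1.
move=> w Ww; have [{}h1 {}h2] := H _ Ww.
have [{}h3 {}h4] := H1 _ Ww; have [{}h5 {}h6] := H2 _ Ww.
have D := corner_slope_across h1 h4 h5 kb.
split; last exact/slope_norm.
set r := w (mid _ (p (j + 1))) in h4 D *; set q := w (mid (p (j + 1)) _) in h5 D *.
set A := w (p j) in h1 h4 D *; set B := w (p (j + 1)) in h1 h4 D *.
rewrite (_ : _ - _ = (r - (A + 3 * B) / 4) +
  (q - r - (B - A) / 2) * (2 * y - 2^-1)); last first.
  by rewrite Ey intrD intrM; field.
exact: affine_error.
Qed.

(** The affine maps of adjacent cells differ by a second difference times an offset of at most 3/2,
    whence 60 = 40 * 3/2. *)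
Lemma near_cell p j z i y : balanced p -> j%:~R <= z < j%:~R + 1 ->
    i%:~R <= y < i%:~R + 1 -> `|y - z| <= 1 ->
  let h := p (j + 1) - p j in
  p (i + 1) - p i <= 2 * h /\ forall w, W w ->
  `|cell_affine w p i y -
    (cell_affine w p j z + (y - z) * (w (p (j + 1)) - w (p j)))|
    <= 60 * (e * h).
Proof.
move=> Hp /andP[jz zj] /andP[iz zi] + h; rewrite ler_norml => /andP[yz zy].
have E : [\/ i = j, i = j + 1 | j = i + 1].
  have k1 : i < j + 2.
    by rewrite -(ltr_int R) intrD; apply: le_lt_trans iz _; lra.
  have k2 : j < i + 2.
    by rewrite -(ltr_int R) intrD; apply: le_lt_trans jz _; lra.
  exact: int_near.
case: E => E; subst.
- have [ab _ _] := Hp j; rewrite /h; split; first by rewrite ler_peMl ?width_ge0 // ler1n.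
  move=> w Ww; rewrite /cell_affine (_ : _ - _ = 0) ?normr0; last by ring.
  by rewrite !mulr_ge0// subr_ge0 ltW.
- have Y : `|y - j%:~R - 2^-1| <= 3 / 2.
    by move: iz zi; rewrite intrD ler_norml => iz zi; apply/andP; split; lra.
  have [ab bc H] := Hp j; have [_ bw] := balanced3_width (Hp j).
  rewrite /h /cell_affine -[j + 1 + 1]addrA (_ : 1 + 1 = 2)//.
  split; first exact: bw.
  move=> w Ww; have [Hw _] := H w Ww.
  set A := w (p j) in Hw *; set B := w (p (j + 1)) in Hw *.
  set C := w (p (j + 2)) in Hw *.
  rewrite (_ : _ - _ = (A + C - 2 * B) * (y - j%:~R - 2^-1)); last first.
    by rewrite intrD; field.
  exact: neighbour_error.
- have Y : `|- (y - i%:~R - 2^-1)| <= 3 / 2.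
    by move: jz zj; rewrite intrD ler_norml => iz' zi'; apply/andP; split; lra.
  have [ab bc H] := Hp i; have [bw _] := balanced3_width (Hp i).
  rewrite /h /cell_affine -[i + 1 + 1]addrA (_ : 1 + 1 = 2)//.
  split; first exact: bw.
  move=> w Ww; have [_ Hw] := H w Ww.
  set A := w (p i) in Hw *; set B := w (p (i + 1)) in Hw *.
  set C := w (p (i + 2)) in Hw *.
  rewrite (_ : _ - _ = (A + C - 2 * B) * (- (y - i%:~R - 2^-1))); last by field.
  exact: neighbour_error.
Qed.

Definition net0_right (L : R) (n : nat) : R * R :=
  iter n (fun q => (q.2, rright q.1 q.2)) (- L, L).

Definition net0_left (L : R) (n : nat) : R * R :=
  iter n (fun q => (rleft q.1 q.2, q.1)) (- L, L).

(** Indices 0 and 1 carry [- L] and [L], and repeated reflection fills both directions. [Negz n] is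
    [-(n + 1)], hence the [n.+1]. *)
Definition net0 (L : R) (i : int) : R :=
  match i with Posz n => (net0_right L n).1 | Negz n => (net0_left L n.+1).1 end.

(** Reflection bounds a second difference by the width of the reflected cell only. [initial_balance]
    transfers the bound to the other width at the cost of a factor 2, well within 40. *)
Lemma net0_balanced L : 0 < L -> balanced (net0 L).
Proof.
move=> L0.
have rlt n : (net0_right L n).1 < (net0_right L n).2.
  by elim: n => [|n IH] /=; [lra|case: (rrightP IH)].
have llt n : (net0_left L n).1 < (net0_left L n).2.
  by elim: n => [|n IH] /=; [lra|case: (rleftP IH)].
have key a b c : a < b -> b < c ->
    (forall w, W w -> `|w a + w c - 2 * w b| <= e * (b - a)) \/
    (forall w, W w -> `|w a + w c - 2 * w b| <= e * (c - b)) -> balanced3 a b c.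
  move=> ab bc H; split => // w Ww.
  have e1' := ek ab; have e2' := ek bc.
  have [|h1 h2] := initial_balance e1' e2' ab bc.
    by case: H => /(_ _ idW); [left|right].
  have g1 := ler_wpM2l e0 h1; have g2 := ler_wpM2l e0 h2.
  rewrite mulrCA in g1; rewrite mulrCA in g2.
  have p1 : 0 <= e * (b - a) by rewrite mulr_ge0// width_ge0.
  have p2 : 0 <= e * (c - b) by rewrite mulr_ge0// width_ge0.
  have le40 (k : R) : 0 <= k -> k <= 40 * k by move=> k0; rewrite ler_peMl// ler1n.
  have le240 (k k' : R) : 0 <= k' -> k <= 2 * k' -> k <= 40 * k'.
    by move=> k0 /le_trans; apply; rewrite ler_wpM2r// ler_nat.
  by case: H => /(_ _ Ww) Hw; split; apply: le_trans Hw _; auto.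
case=> [n|n].
- have [-> ->] := PoszD12 n.
  have [h1 h2] := rrightP (rlt n).
  by apply: key; [exact: rlt|exact: h1|left].
- case: n => [|[|n]].
  + rewrite (_ : Negz 0 + 1 = 0)// (_ : Negz 0 + 2 = 1)//=.
    have L2 : - L < L by lra.
    by have [h1 h2] := rleftP L2; apply: key; [exact: h1|exact: L2|right].
  + rewrite (_ : Negz 1 + 1 = Negz 0)// (_ : Negz 1 + 2 = 0)//.
    have [h1 h2] := rleftP (llt 1%N).
    by apply: key; [exact: h1|exact: (llt 1%N)|right].
  + have [-> ->] := NegzD12 n; have [h1 h2] := rleftP (llt n.+2).
    by apply: key; [exact: h1|exact: (llt n.+2)|right].
Qed.

End Nets.

(** * Limits of the nets *)

Lemma exp_gt_exists (R : realType) (q x : R) : 1 < q -> exists n, x < q ^+ n.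
Proof.
move=> q1; have [n Hn] : exists n : nat, x < n%:R * (q - 1).
  exists (Num.truncn (x / (q - 1))).+1.
  rewrite -ltr_pdivrMr ?subr_gt0//.
  exact: truncnS_gt.
exists n; apply: lt_le_trans Hn _.
suff : 1 + n%:R * (q - 1) <= q ^+ n by lra.
elim: n => [|n IH]; first by rewrite mul0r addr0 expr0.
rewrite exprS -natr1.
have n0 : 0 <= n%:R * ((q - 1) * (q - 1)) by rewrite !mulr_ge0//; lra.
have := ler_wpM2l (ltW (lt_trans ltr01 q1)) IH; lra.
Qed.

Lemma dyadic_scale (R : realType) (t : R) : 0 < t <= 1 ->
  exists n : nat, 2^-1 <= 2 ^+ n * t <= 1.
Proof.
move=> /andP[t0 t1].
have ex : exists n, 2^-1 <= 2 ^+ n * t.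
  have [n Hn] := @exp_gt_exists R 2 t^-1 (ltr1n _ _).
  exists n; have := Hn; rewrite -[t^-1]mul1r ltr_pdivrMr//; lra.
case: (ex_minnP ex) => -[|n] Hn Hmin; first by exists 0%N; rewrite Hn/= mul1r.
exists n.+1; rewrite Hn/= leNgt; apply/negP => H.
have : 2^-1 <= 2 ^+ n * t by move: H; rewrite exprS; lra.
by move=> /Hmin; rewrite ltnn.
Qed.

Lemma ultra_nat : exists U : set_system nat, UltraFilter U /\ \oo `<=` U.
Proof. exact: ultraFilterLemma. Qed.

(** Along one fixed ultrafilter the limits exist at all real points at once, so no diagonal
    extraction is needed. *)
Lemma ultra_bounded_cvg (R : realType) (U : set_system nat) (f : nat -> R) M :
  UltraFilter U -> (\forall n \near U, `|f n| <= M) -> exists l : R, f @ U --> l.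
Proof.
move=> UU HM.
have FM : (f @ U) `[- M, M]%classic.
  by apply: filterS HM => n; rewrite /= in_itv/= ler_norml.
have [l [_ Hl]] := @segment_compact R _ _ _ (fmap_proper_filter f ultra_proper) FM.
exists l => A nA.
have [//|nUA] := @in_ultra_setVsetC _ U (f @^-1` A) UU.
by have [y [ny Ay]] := Hl (~` A) A nUA nA.
Qed.

Lemma le_geometric_cvg0 (R : realType) (u : R^nat) (C q : R) : `|q| < 1 ->
  (forall n, `|u n| <= C * q ^+ n) -> u @ \oo --> (0 : R).
Proof.
move=> q1 uq; apply: norm_cvg0.
apply: (@squeeze_cvgr _ _ _ _ (fun=> 0) (geometric C q)).
- by apply: nearW => n; rewrite normr_ge0/=; exact: uq.
- exact: cvg_cst.
- exact: cvg_geometric.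
Qed.

Lemma cvg_dist_le (R : realType) (T : Type) (F : set_system T)
    {FF : ProperFilter F} (f : T -> R) (l c b : R) :
  f @ F --> l -> (\near F, `|f F - c| <= b) -> `|l - c| <= b.
Proof.
move=> fl; apply: cvgr_to_le.
by apply: cvg_norm; apply: cvgB => //; exact: cvg_cst.
Qed.

Section Telescope.
Context {R : realType}.
Implicit Types (e d k A B C D X Y Z : R).

(** Widths shrink by 7/10, so [60 d <= 200 (d - d')]: stated with [d0 - d], the errors telescope. *)
Lemma telescope_step e d (d' d0 : R) X Y Z : 0 <= e -> d' <= 7 / 10 * d ->
    `|X - Y| <= 60 * (e * d) -> `|Y - Z| <= 200 * (e * (d0 - d)) ->
  `|X - Z| <= 200 * (e * (d0 - d')).
Proof.
move=> e0 /(ler_wpM2l e0) h1 h2 h3; rewrite -(subrKA Y).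
apply: le_trans (ler_normD _ _) _; apply: le_trans (lerD h2 h3) _; lra.
Qed.

(** The slope of [w] is halved only up to an error proportional to the width, so slope and width are
    estimated together: 7/10 + 13/1000 <= 3/4. *)
Lemma decay_step e d (d' : R) X Y : 0 <= d -> e * d <= 1000^-1 * d ->
    d' <= 7 / 10 * d -> 0 <= X -> Y <= 2^-1 * X + 13 * (e * d) ->
  Y + d' <= 3 / 4 * (X + d).
Proof. lra. Qed.

Lemma second_diff_of_affine A C k X Y D : `|X - (A + D)| <= 460 * k ->
    `|Y - (A - D)| <= 460 * k -> `|C - A| <= 200 * k -> 
  `|X + Y - 2 * C| <= 1320 * k.
Proof.
rewrite !ler_norml => /andP[? ?] /andP[? ?] /andP[? ?].
by apply/andP; split; lra.
Qed.

(** [2 D >= d], and the total error [920 k] stays below [d / 2] because [k <= d / 2000]; this fixes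
    the smallness asked of [e]. *)
Lemma increment_of_affine A k d X Y D : `|X - (A + D)| <= 460 * k ->
    `|Y - (A - D)| <= 460 * k -> k <= 2000^-1 * d -> d / 2 <= D ->
  2^-1 * d <= X - Y.
Proof. by rewrite !ler_norml => /andP[? ?] /andP[? ?] ? ?; lra. Qed.

Lemma near_bound k (l : R) e : e * l <= e * (2 * k) ->
  200 * (e * l) + 60 * (e * k) <= 460 * (e * k).
Proof. lra. Qed.

Lemma scale_bound k (l : R) : 0 <= k -> 2^-1 * k <= l -> 1320 * k <= 3000 * l.
Proof. lra. Qed.

Lemma initial_left (L r x k : R) :
    `|x - (r + 1 * (- L - r))| <= 200 * k -> k <= 2000^-1 * (- L - r) ->
    - L - r <= 2 * (L - - L) -> x <= - (L / 2).
Proof. rewrite ler_norml => /andP[? ?] ? ?; lra. Qed.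

Lemma initial_right (L x k : R) :
    `|x - (- L + 1 * (L - - L))| <= 200 * k -> k <= 2000^-1 * (L - - L) ->
    L / 2 <= x.
Proof. rewrite ler_norml => /andP[? ?] ?; lra. Qed.

End Telescope.

Section NetLimit.
Context {R : realType} (e : R) (W : set (R -> R)).
Variables (mid rright rleft : R -> R -> R).
Hypotheses (e02 : 0 <= e <= 2000^-1) (idW : W id).
Hypothesis midP : forall a b, a < b -> a < mid a b < b /\
  forall w, W w -> `|w a + w b - 2 * w (mid a b)| <= e * (b - a).
Hypothesis rrightP : forall a b, a < b -> b < rright a b /\
  forall w, W w -> `|w a + w (rright a b) - 2 * w b| <= e * (b - a).
Hypothesis rleftP : forall a b, a < b -> rleft a b < a /\
  forall w, W w -> `|w (rleft a b) + w b - 2 * w a| <= e * (b - a).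
Hypothesis contW : forall w, W w -> continuous w.
Variables (L : R) (L0 : 0 < L).

Let e0 : 0 <= e. Proof. by case/andP: e02. Qed.

Let e01 : 0 <= e <= 1000^-1.
Proof.
by case/andP: e02 => -> e2 /=; lra.
Qed.

Let net n := iter n (net_step mid) (net0 rright rleft L).
Let cell n (x : R) := Num.floor (2 ^+ n * x).
Let width n x := net n (cell n x + 1) - net n (cell n x).
(** Between generations the net point itself moves by an amount comparable to the slope, which for a
    steep [g] is not bounded by the width; the extrapolated value moves by [O(e * width)] only. Both
    have the same limit. *)
Let aff w n x := cell_affine w (net n) (cell n x) (2 ^+ n * x).
Let slope (w : R -> R) n x := w (net n (cell n x + 1)) - w (net n (cell n x)).

Let net_balanced n : balanced e W (net n).
Proof.
elim: n => [|n IH]; first exact: net0_balanced.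
exact: net_step_balanced.
Qed.

Let cellP n x : (cell n x)%:~R <= 2 ^+ n * x < (cell n x)%:~R + 1.
Proof. by have := floor_itv (2 ^+ n * x); rewrite intrD. Qed.

Let width_gt0 n x : 0 < width n x.
Proof. by rewrite subr_gt0; case: (net_balanced n (cell n x)). Qed.

Let le2000 (d : R) : 0 < d -> e * d <= 2000^-1 * d.
Proof. by move=> d0; rewrite ler_wpM2r ?(ltW d0)//; case/andP: e02. Qed.

Let width_k n x : 0 <= e * width n x.
Proof. by rewrite mulr_ge0// ltW. Qed.

Let net_succ n x : width n.+1 x <= 7 / 10 * width n x /\ forall w, W w ->
  `|aff w n.+1 x - aff w n x| <= 60 * (e * width n x) /\
  `|slope w n.+1 x| <= 2^-1 * `|slope w n x| + 13 * (e * width n x).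
Proof.
have := @net_step_cell _ _ _ _ e01 idW midP (net n) (cell n x) (2 ^+ n * x)
  (cell n.+1 x) (net_balanced n) (cellP n x).
have -> : 2 * (2 ^+ n * x) = 2 ^+ n.+1 * x by rewrite exprS mulrA.
move=> /(_ (cellP n.+1 x)) [h1 h2].
by split => // w Ww; exact: h2.
Qed.

Let aff_close w n m x : W w ->
  `|aff w (n + m) x - aff w n x| <= 200 * (e * width n x).
Proof.
move=> Ww.
suff /le_trans : `|aff w (n + m) x - aff w n x| <=
    200 * (e * (width n x - width (n + m) x)).
  by apply; rewrite !ler_wpM2l// lerBlDr lerDl ltW.
elim: m => [|m IH]; first by rewrite addn0 !subrr normr0 !mulr0.
have [h1 /(_ _ Ww)[h2 _]] := net_succ (n + m) x.
by rewrite addnS; exact: telescope_step h1 h2 IH.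
Qed.

Let slope_decay w n x : W w ->
  `|slope w n x| + width n x <= (3 / 4) ^+ n * (`|slope w 0 x| + width 0 x).
Proof.
move=> Ww; elim: n => [|n IH]; first by rewrite expr0 mul1r.
have [h1 /(_ _ Ww)[_ h2]] := net_succ n x.
have ew : e * width n x <= 1000^-1 * width n x.
  by rewrite ler_wpM2r ?(ltW (width_gt0 n x))//; case/andP: e01.
have := decay_step (ltW (width_gt0 n x)) ew h1 (normr_ge0 _) h2.
move=> /le_trans; apply; rewrite exprS -[leRHS]mulrA.
by rewrite ler_wpM2l// divr_ge0.
Qed.

Let cell_offset n x : `|2 ^+ n * x - (cell n x)%:~R + 2^-1| <= 2.
Proof. have := cellP n x; rewrite ler_norml => /andP[? ?]; lra. Qed.

Let aff_sub w n x : W w -> `|aff w n x - w (net n (cell n x))| <=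
  2 * (3 / 4) ^+ n * (`|slope w 0 x| + width 0 x).
Proof.
move=> Ww; rewrite /aff /cell_affine addrAC subrr add0r normrM.
have h := ler_pM (normr_ge0 _) (normr_ge0 _) (cell_offset n x)
  (lexx `|slope w n x|).
apply: le_trans h _; rewrite -mulrA ler_wpM2l//.
by apply: le_trans (slope_decay n x Ww); rewrite lerDl ltW.
Qed.

Lemma net_limit : exists u : R -> R,
  [/\ (forall x t, 0 < t <= 1 -> 0 <= u (x + t) - u (x - t) /\
       forall w, W w -> `|w (u (x + t)) + w (u (x - t)) - 2 * w (u x)| <=
         3000 * e * (u (x + t) - u (x - t))),
     u (- 2^-1) <= - (L / 2) & L / 2 <= u (2^-1)].
Proof.
have [U [UU ooU]] := ultra_nat.
have decay0 w x : W w -> (fun n => aff w n x - w (net n (cell n x))) @ U --> (0 : R).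
  move=> Ww; apply: cvg_trans (cvg_app _ ooU) _.
  apply: (@le_geometric_cvg0 _ _ (2 * (`|slope w 0 x| + width 0 x)) (3 / 4)).
    by rewrite ger0_norm; lra.
  by move=> n; rewrite mulrAC; exact: aff_sub.
have /choice[u uP] : forall x, exists l : R, (fun n => net n (cell n x)) @ U --> l.
  move=> x; apply: (@ultra_bounded_cvg _ _ _ (`|aff id 0 x| +
    200 * (e * width 0 x) + 2 * (`|slope id 0 x| + width 0 x))).
  apply: nearW => n.
  rewrite (_ : net n _ = aff id 0 x + (aff id n x - aff id 0 x) -
    (aff id n x - net n (cell n x))); last by ring.
  apply: le_trans (ler_normB _ _) _; rewrite lerD//.
    apply: le_trans (ler_normD _ _) _; rewrite lerD//.
    exact: (aff_close 0 n x idW).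
  apply: le_trans (aff_sub n x idW) _.
  rewrite -mulrA ler_wpM2l// ler_piMl//.
    by rewrite (addr_ge0 (normr_ge0 _) (ltW (width_gt0 0 x))).
  by apply: exprn_ile1; lra.
have affu w x : W w -> (fun n => aff w n x) @ U --> w (u x).
  move=> Ww; rewrite -[w (u x)]add0r.
  rewrite (_ : (fun n => aff w n x) =
    (fun n => (aff w n x - w (net n (cell n x))) + w (net n (cell n x)))).
    apply: cvgD; first exact: decay0.
    by apply: cvg_comp (uP x) _; exact: contW.
  by apply/funext => n; rewrite subrK.
have ulim w n x : W w -> `|w (u x) - aff w n x| <= 200 * (e * width n x).
  move=> Ww.
  apply: (cvg_dist_le (affu w x Ww)); apply: ooU; exists n => // m /= nm.
  by rewrite -(subnKC nm); exact: aff_close.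
have near_u w n x y : W w -> `|2 ^+ n * y - 2 ^+ n * x| <= 1 ->
    `|w (u y) - (aff w n x + (2 ^+ n * y - 2 ^+ n * x) * slope w n x)| <=
    460 * (e * width n x).
  move=> Ww xy.
  have [h1 h2] := near_cell e01 idW (net_balanced n) (cellP n x) (cellP n y) xy.
  rewrite -(subrKA (aff w n y)); apply: le_trans (ler_normD _ _) _.
  apply: le_trans (lerD (ulim w n y Ww) (h2 w Ww)) _.
  exact: near_bound (ler_wpM2l e0 h1).
exists u; split.
(* With [2^n t] in [[1/2, 1]], the points [x + t] and [x - t] lie at most one cell from [x], yet far
   enough apart for the increment to reach half a width. *)
- move=> x t /dyadic_scale[n /andP[tn nt]].
  have E1 : 2 ^+ n * (x + t) - 2 ^+ n * x = 2 ^+ n * t by ring.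
  have E2 : 2 ^+ n * (x - t) - 2 ^+ n * x = - (2 ^+ n * t) by ring.
  have t0 : 0 <= 2 ^+ n * t by apply: le_trans tn; rewrite invr_ge0.
  have nr w (Ww : W w) := near_u w n x (x + t) Ww.
  have nl w (Ww : W w) := near_u w n x (x - t) Ww.
  rewrite E1 ger0_norm// in nr; rewrite E2 normrN ger0_norm// in nl.
  have inc : 2^-1 * width n x <= u (x + t) - u (x - t).
    have h1 := nr _ idW nt; have h2 := nl _ idW nt; rewrite mulNr in h2.
    apply: increment_of_affine h1 h2 _ _.
      exact: le2000.
    by rewrite mulrC ler_wpM2r// ltW.
  split.
    by apply: le_trans inc; rewrite mulr_ge0 ?invr_ge0// ltW.
  move=> w Ww; have h1 := nr _ Ww nt; have h2 := nl _ Ww nt; rewrite mulNr in h2.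
  (* 1320 = 2 * 460 + 2 * 200, and the increment is at least half a width, so a factor 2640 would
     do; it is rounded up to 3000. *)
  apply: le_trans (second_diff_of_affine h1 h2 (ulim w n x Ww)) _.
  have := ler_wpM2l e0 inc; rewrite mulrCA -mulrA.
  exact: scale_bound (width_k n x).
(* Because of the offset in [cell_affine], the initial extrapolation is exactly [- L] at -1/2 and
   [L] at 1/2; the limit moves it by at most a tenth of a width. *)
- have c0 : cell 0 (- 2^-1) = -1.
    by apply: floor_def; rewrite expr0 mul1r; apply/andP; split; lra.
  move: (ulim id 0%N (- 2^-1) idW).
  have [h1 _] := balanced3_width e01 idW (net_balanced 0%N (-1)).
  rewrite /aff /cell_affine c0 expr0 mul1r => h2.
  have h3 := le2000 (width_gt0 0%N (- 2^-1)); rewrite /width c0 in h2 h3.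
  rewrite (_ : - 2^-1 - (-1)%:~R + 2^-1 = 1 :> R) in h2; last first.
    by rewrite mulrN1z; ring.
  exact: initial_left h2 h3 h1.
- have c0 : cell 0 (2^-1) = 0.
    by apply: floor_def; rewrite expr0 mul1r; apply/andP; split; lra.
  have h2 := ulim id 0%N (2^-1) idW.
  rewrite /aff /cell_affine c0 expr0 mul1r in h2.
  have h3 := le2000 (width_gt0 0%N (2^-1)); rewrite /width c0 in h2 h3.
  rewrite (_ : 2^-1 - 0%:~R + 2^-1 = 1 :> R) in h2; last by field.
  exact: initial_right h2 h3.
Qed.

End NetLimit.

(** * Zygmund-type parametrizations *)

Section Zygmund.
Context {R : realType}.

(* [W] will be [{id, g}], so that the complex map [u + i g(u)] has second
   differences dominated by the increments of its real part. *)
Definition zygmund (W : set (R -> R)) (c T : R) (u : R -> R) :=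
  forall x t, 0 < t <= T -> 0 <= u (x + t) - u (x - t) /\
    forall w, W w -> `|w (u (x + t)) + w (u (x - t)) - 2 * w (u x)| <=
      c * (u (x + t) - u (x - t)).

Lemma zygmund_affine W c T u a b : 0 < b -> zygmund W c (b * T) u ->
  zygmund W c T (fun x => u (a + b * x)).
Proof.
move=> b0 Z x t /andP[t0 tT].
rewrite mulrDr mulrBr !addrA; apply: Z.
by rewrite mulr_gt0//= ler_pM2l.
Qed.

Lemma zygmund_half_bound (c d d1 d2 : R) : c <= 6^-1 -> 0 <= d ->
    `|d2 - d1| <= c * d -> d = d1 + d2 ->
  d <= 4 * d1 /\ d1 <= 2 / 3 * d.
Proof.
move=> c6 d0; rewrite ler_norml => /andP[h1 h2] E.
have := ler_wpM2r d0 c6; lra.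
Qed.

(** [|X| <= |Y| / 2 + d / 12], and 1/12 + 7/12 = 2/3. Adding the real increment makes the
    contraction rate the same for every [w]. *)
Lemma zygmund_slope_bound (c d X Y : R) : c <= 6^-1 -> 0 <= d ->
  `|2 * X - Y| <= c * d -> `|X| + 7 / 12 * d <= 2 / 3 * (`|Y| + d).
Proof.
move=> c6 d0 H; have := ler_wpM2r d0 c6.
have := ler_normD (2 * X - Y) Y; rewrite subrK normrM ger0_norm//.
have := normr_ge0 Y; lra.
Qed.

Lemma zygmund_third_bound (c d d1 d2 : R) : c <= 6^-1 -> 0 <= d ->
    `|d2 - d1| <= c * d -> d = d1 + d2 -> d1 <= 7 / 12 * d.
Proof.
move=> c6 d0; rewrite ler_norml => /andP[h1 h2] E.
have := ler_wpM2r d0 c6; lra.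
Qed.

Section Theory.
Variables (W : set (R -> R)) (c T : R) (u : R -> R).
Hypotheses (idW : W id) (c6 : c <= 6^-1) (Z : zygmund W c T u).

Lemma zygmund_mono x y : x <= y <= x + 2 * T -> u x <= u y.
Proof.
move=> /andP[]; rewrite le_eqVlt => /predU1P[->//|xy yT].
have [|h _] := Z (x + (y - x) / 2) (t := (y - x) / 2).
  by rewrite divr_gt0 ?subr_gt0// ler_pdivrMr//; lra.
move: h; rewrite subr_ge0 addrK -addrA.
by rewrite -mulrDl -mulr2n -[_ *+ 2]mulr_natr mulfK// subrKC.
Qed.

Lemma zygmund_half_right x h : 0 < h <= T ->
  u (x + 2 * h) - u x <= 4 * (u (x + h) - u x) /\
  u (x + h) - u x <= 2 / 3 * (u (x + 2 * h) - u x).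
Proof.
move=> hT; have [h1 /(_ _ idW) h2] := Z (x + h) hT.
rewrite addrK (_ : x + h + h = x + 2 * h) in h1 h2; last by ring.
apply: (@zygmund_half_bound c _ _ (u (x + 2 * h) - u (x + h)) c6 h1); last by ring.
by apply: le_trans h2; rewrite le_eqVlt; apply/orP; left; apply/eqP; congr `|_|; ring.
Qed.

Lemma zygmund_half_left x h : 0 < h <= T ->
  u x - u (x - h) <= 2 / 3 * (u x - u (x - 2 * h)).
Proof.
move=> hT; have [h1 /(_ _ idW) h2] := Z (x - h) hT.
rewrite subrK (_ : x - h - h = x - 2 * h) in h1 h2; last by ring.
have [] // := zygmund_half_bound (d1 := u x - u (x - h))
  (d2 := u (x - h) - u (x - 2 * h)) c6 h1 _ _; last by ring.
by rewrite -normrN; apply: le_trans h2; rewrite le_eqVlt; apply/orP; left; apply/eqP; congr `|_|; ring.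
Qed.

Lemma zygmund_half_slope w x h : W w -> 0 < h <= T ->
  `|w (u (x + h)) - w (u x)| + (u (x + h) - u x) <=
  2 / 3 * (`|w (u (x + 2 * h)) - w (u x)| + (u (x + 2 * h) - u x)).
Proof.
move=> Ww hT; have [h1 h2] := Z (x + h) hT.
rewrite addrK (_ : x + h + h = x + 2 * h) in h1 h2; last by ring.
have h3 := h2 _ idW; have h4 := h2 _ Ww.
have h5 : u (x + h) - u x <= 7 / 12 * (u (x + 2 * h) - u x).
  apply: (zygmund_third_bound (d2 := u (x + 2 * h) - u (x + h)) c6 h1); last by ring.
  by apply: le_trans h3; rewrite le_eqVlt; apply/orP; left; apply/eqP; congr `|_|; ring.
apply: le_trans (lerD (lexx _) h5) _.
apply: (zygmund_slope_bound c6 h1).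
by apply: le_trans h4; rewrite -normrN le_eqVlt; apply/orP; left; apply/eqP; congr `|_|; ring.
Qed.

Lemma zygmund_dyadic_slope w x h n : W w -> 0 < h -> h <= 2 * T ->
  `|w (u (x + h / 2 ^+ n)) - w (u x)| + (u (x + h / 2 ^+ n) - u x) <=
  (2 / 3) ^+ n * (`|w (u (x + h)) - w (u x)| + (u (x + h) - u x)).
Proof.
move=> Ww h0 hT; elim: n => [|n IH]; first by rewrite !expr0 divr1 mul1r.
have p2 : 0 < 2 ^+ n :> R by rewrite exprn_gt0.
have E : 2 * (h / 2 ^+ n.+1) = h / 2 ^+ n.
  by rewrite exprS; field; rewrite gt_eqF.
have := @zygmund_half_slope w x (h / 2 ^+ n.+1) Ww; rewrite E => /(_ _)/le_trans; apply.
  rewrite divr_gt0 ?exprn_gt0//= -(@ler_pM2l _ 2)// E.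
  apply: le_trans hT; rewrite ler_pdivrMr// ler_peMr ?(ltW h0)//.
  by rewrite exprn_ege1// ler1n.
by rewrite exprS -[leRHS]mulrA ler_wpM2l// divr_ge0.
Qed.

Hypothesis T1 : 1 <= T.

Lemma zygmund_continuous : continuous u.
Proof.
move=> x; apply/cvgrPdist_lt => e e0.
pose C := u (x + 1) - u (x - 1).
have T1' := T1; have TT : 0 < T by lra.
have C0 : 0 <= C by rewrite subr_ge0; apply: zygmund_mono; apply/andP; split; lra.
have right n : u (x + 1 / 2 ^+ n) - u x <= (2 / 3) ^+ n * C.
  elim: n => [|n IH].
    rewrite expr0 divr1 mul1r lerD2l lerN2; apply: zygmund_mono; apply/andP; split; lra.
  have p2 : 0 < 2 ^+ n :> R by rewrite exprn_gt0.
  have E : 2 * (1 / 2 ^+ n.+1) = 1 / 2 ^+ n :> R.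
    by rewrite exprS; field; rewrite gt_eqF.
  have [|_] := @zygmund_half_right x (1 / 2 ^+ n.+1).
    rewrite divr_gt0 ?exprn_gt0//=; apply: le_trans T1.
    by rewrite ler_pdivrMr ?exprn_gt0// mul1r exprn_ege1// ler1n.
  rewrite E => /le_trans; apply.
  by rewrite exprS -[leRHS]mulrA ler_wpM2l// divr_ge0.
have left n : u x - u (x - 1 / 2 ^+ n) <= (2 / 3) ^+ n * C.
  elim: n => [|n IH].
    rewrite expr0 divr1 mul1r lerD2r; apply: zygmund_mono; apply/andP; split; lra.
  have p2 : 0 < 2 ^+ n :> R by rewrite exprn_gt0.
  have E : 2 * (1 / 2 ^+ n.+1) = 1 / 2 ^+ n :> R.
    by rewrite exprS; field; rewrite gt_eqF.
  have := @zygmund_half_left x (1 / 2 ^+ n.+1); rewrite E => /(_ _)/le_trans; apply.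
    rewrite divr_gt0 ?exprn_gt0//=; apply: le_trans T1.
    by rewrite ler_pdivrMr ?exprn_gt0// mul1r exprn_ege1// ler1n.
  by rewrite exprS -[leRHS]mulrA ler_wpM2l// divr_ge0.
have [n Hn] := @exp_gt_exists R (3 / 2) (C / e) ltac:(lra).
have small : (2 / 3) ^+ n * C < e.
  rewrite ltr_pdivrMr// in Hn.
  have -> : (2 / 3 : R) = (3 / 2)^-1 by rewrite invf_div.
  have q0 : 0 < (3 / 2) ^+ n :> R by rewrite exprn_gt0.
  by rewrite exprVn mulrC ltr_pdivrMr // mulrC.
have p2 : 0 < 1 / 2 ^+ n :> R by rewrite divr_gt0// exprn_gt0.
have p1 : 1 / 2 ^+ n <= 1 :> R.
  by rewrite ler_pdivrMr ?exprn_gt0// mul1r exprn_ege1// ler1n.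
near=> y.
have : `|x - y| < 1 / 2 ^+ n by near: y; exact: (@cvgr_dist_lt _ _ _ _ _ id).
rewrite ltr_norml => /andP[h1 h2].
apply: le_lt_trans small; have := right n; have := left n.
rewrite ler_norml; have [xy|yx] := leP x y.
  have : u x <= u y by apply: zygmund_mono; apply/andP; split; lra.
  have : u y <= u (x + 1 / 2 ^+ n) by apply: zygmund_mono; apply/andP; split; lra.
  by move=> ? ? ? ?; apply/andP; split; lra.
have : u y <= u x by apply: zygmund_mono; apply/andP; split; lra.
have : u (x - 1 / 2 ^+ n) <= u y by apply: zygmund_mono; apply/andP; split; lra.
by move=> ? ? ? ?; apply/andP; split; lra.
Unshelve. all: by end_near. Qed.

(** The bound depends on neither [u] nor [T], as the limit over a sequence of parametrizations
    requires. Doubling multiplies values on the right by at most 4, and the second difference at 0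
    carries the bound to the left with a factor below 2. *)
Lemma zygmund_growth k : 2 ^+ k <= T -> u 0 = 0 -> u 1 = 1 ->
  forall x, `|x| <= 2 ^+ k -> `|u x| <= 2 * 4 ^+ k.
Proof.
move=> kT u0 u1 x; rewrite ler_norml => /andP[xl xr].
have p2 j : 0 < 2 ^+ j :> R by rewrite exprn_gt0.
have right j : 2 ^+ j <= T -> u (2 ^+ j) <= 4 ^+ j.
  elim: j => [|j IH] jT; first by rewrite !expr0 u1.
  have jT' : 2 ^+ j <= T.
    by apply: le_trans jT; rewrite exprS; have := p2 j; lra.
  have [|h _] := @zygmund_half_right 0 (2 ^+ j); first by rewrite p2.
  rewrite u0 !add0r !subr0 -exprS in h; apply: le_trans h _.
  by rewrite [leRHS]exprS ler_wpM2l// IH.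
have [|_ /(_ _ idW)] := Z 0 (t := 2 ^+ k); first by rewrite p2.
rewrite u0 add0r sub0r ler_norml => /andP[h1 h2].
have h3 := right k kT; have pk := p2 k.
have m0 : 0 <= u (2 ^+ k) - u (- 2 ^+ k).
  rewrite subr_ge0; apply: zygmund_mono; apply/andP; split; lra.
have h4 := ler_wpM2r m0 c6.
have m1 : u x <= u (2 ^+ k) by apply: zygmund_mono; apply/andP; split; lra.
have m2 : u (- 2 ^+ k) <= u x by apply: zygmund_mono; apply/andP; split; lra.
have p4 : 0 < 4 ^+ k :> R by rewrite exprn_gt0.
rewrite ler_norml; apply/andP.
by move: h1 h2 h3 m0 h4 m1 m2 p4; clear; split; lra.
Qed.

End Theory.
End Zygmund.

(** * Normalization and passage to all scales *)

Section Parametrization.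
Context {R : realType} (W : set (R -> R)) (c : R).
Hypotheses (idW : W id) (contW : forall w, W w -> continuous w).
Hypothesis c6 : c <= 6^-1.

(** Halving a step divides an increment by at most 4. An increment of at least [4^n] over unit
    length therefore leaves at least 1 over length [2^-n], so [u] takes the values 0 and 1 at points
    at most [2^-n] apart. Stretching these points to 0 and 1 enlarges the range of [t] from 1 to
    [2^n]. *)
Lemma zygmund_normalize L n u : zygmund W c 1 u -> 2 * 4 ^+ n <= L ->
    u (- 2^-1) <= - (L / 2) -> L / 2 <= u (2^-1) ->
  exists2 v, zygmund W c (2 ^+ n) v & v 0 = 0 /\ v 1 = 1.
Proof.
move=> Z Ln ul ur.
have mono := @zygmund_mono _ W c 1 u Z.
have cu := @zygmund_continuous _ W c 1 u idW c6 Z (lexx 1).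
have p4 : 0 < 4 ^+ n :> R by rewrite exprn_gt0.
have p2 : 0 < 2 ^+ n :> R by rewrite exprn_gt0.
have [|||x0] := @IVT R u (- 2^-1) (2^-1) 0; first lra.
- exact: continuous_subspaceT.
- rewrite ge_min le_max; apply/andP; split; apply/orP; [left|right]; lra.
rewrite in_itv/= => /andP[x0l x0r] ux0.
have far : L / 2 <= u (x0 + 1).
  by apply: le_trans ur _; apply: mono; apply/andP; split; lra.
have down m : u (x0 + 1) <= 4 ^+ m * u (x0 + 1 / 2 ^+ m).
  elim: m => [|m IH]; first by rewrite !expr0 divr1 mul1r.
  apply: le_trans IH _; rewrite exprSr -mulrA ler_wpM2l ?exprn_ge0//.
  have q2 : 0 < 2 ^+ m :> R by rewrite exprn_gt0.
  have E : 2 * (1 / 2 ^+ m.+1) = 1 / 2 ^+ m :> R.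
    by rewrite exprS; field; rewrite gt_eqF.
  have [|h _] := @zygmund_half_right _ W c 1 u idW c6 Z x0 (1 / 2 ^+ m.+1).
    by rewrite divr_gt0 ?exprn_gt0//= ler_pdivrMr ?exprn_gt0// mul1r exprn_ege1// ler1n.
  by move: h; rewrite E ux0 !subr0.
have one : 1 <= u (x0 + 1 / 2 ^+ n).
  by rewrite -(ler_pM2l p4); apply: le_trans (down n); apply: le_trans far; lra.
have h0 : 0 < 1 / 2 ^+ n :> R by rewrite divr_gt0.
have [|||x1] := @IVT R u x0 (x0 + 1 / 2 ^+ n) 1; first lra.
- exact: continuous_subspaceT.
- by rewrite ge_min le_max ux0 ler01 one orbT.
rewrite in_itv/= => /andP[x1l x1r] ux1.
have b0 : 0 < x1 - x0.
  rewrite subr_gt0 lt_neqAle x1l andbT; apply/eqP => E.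
  by move: ux1; rewrite -E ux0 => /esym/eqP; rewrite oner_eq0.
exists (fun x => u (x0 + (x1 - x0) * x)); last first.
  by rewrite mulr0 addr0 mulr1 subrKC.
apply: (zygmund_affine _ b0).
move=> x t /andP[t0 tT]; apply: Z; rewrite t0/=; apply: le_trans tT _.
by rewrite -ler_pdivlMr//; lra.
Qed.

Lemma zygmund_limit : 
    (forall n, exists2 v, zygmund W c (2 ^+ n) v & v 0 = 0 /\ v 1 = 1) ->
  exists u, [/\ forall T, zygmund W c T u, u 0 = 0 & u 1 = 1].
Proof.
move=> H.
have /choice[v vP] : forall n, exists v, zygmund W c (2 ^+ n) v /\ v 0 = 0 /\ v 1 = 1.
  by move=> n; have [v Zv v01] := H n; exists v.
have [U [UU ooU]] := ultra_nat.
have big (T : R) : exists k, forall n, (k <= n)%N -> T <= 2 ^+ n.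
  have [k Hk] := @exp_gt_exists R 2 T (ltr1n _ _); exists k => n kn.
  by apply: le_trans (ltW Hk) _; rewrite ler_weXn2l// ler1n.
have large k : \forall n \near U, (k <= n)%N by apply: ooU; exists k.
have /choice[u uP] : forall x, exists l : R, v n x @[n --> U] --> l.
  move=> x; have [k Hk] := big `|x|.
  apply: (@ultra_bounded_cvg _ _ _ (2 * 4 ^+ k)).
  apply: filterS (large k) => n kn; have [Z [v0 v1]] := vP n.
  apply: (zygmund_growth idW c6 Z) => //; last exact: Hk.
  by rewrite ler_weXn2l// ler1n.
have ucst x (a : R) : (forall n, v n x = a) -> u x = a.
  move=> va; apply/eqP; rewrite -subr_eq0 -normr_le0.
  by apply: (cvg_dist_le (uP x)); apply: nearW => n; rewrite va subrr normr0.
exists u; split; last 2 first.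
- by apply: ucst => n; case: (vP n) => _ [].
- by apply: ucst => n; case: (vP n) => _ [].
move=> T x t /andP[t0 tT].
have [k Hk] := big T.
have Zn : \forall n \near U, 0 < t <= 2 ^+ n.
  by apply: filterS (large k) => n kn; rewrite t0 (le_trans tT)// Hk.
have incr : v n (x + t) - v n (x - t) @[n --> U] --> u (x + t) - u (x - t).
  by apply: cvgB.
split.
  apply: (@cvgr_to_ge _ _ _ _ _ _ _ incr).
  by apply: filterS Zn => n tn; case: (vP n) => Z _; case: (Z x t tn).
move=> w Ww.
have cw y : w (v n y) @[n --> U] --> w (u y).
  by apply: cvg_comp (uP y) _; exact: contW.
have lhs : `|w (v n (x + t)) + w (v n (x - t)) - 2 * w (v n x)| @[n --> U] -->
    `|w (u (x + t)) + w (u (x - t)) - 2 * w (u x)|.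
  apply: cvg_norm; apply: cvgB; first by apply: cvgD.
  by apply: cvgM => //; exact: cvg_cst.
have rhs : c * (v n (x + t) - v n (x - t)) @[n --> U] --> c * (u (x + t) - u (x - t)).
  by apply: cvgM => //; exact: cvg_cst.
have LE : \forall n \near U, `|w (v n (x + t)) + w (v n (x - t)) - 2 * w (v n x)| <=
    c * (v n (x + t) - v n (x - t)).
  apply: filterS Zn => n tn; case: (vP n) => Z _; case: (Z x t tn) => _; exact.
exact: ler_cvg_to lhs rhs LE.
Qed.

End Parametrization.

Section GraphParametrization.
Context {R : realType}.

(** [12 * Num.sqrt s] is the error of reflection on the graph, 3000 the loss in [net_limit]. *)
Definition qs_const (s : R) : R := 3000 * (12 * Num.sqrt s).

Lemma qs_const_bounds s : 12 * qs_const s < 1 ->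
  [/\ 0 <= 12 * Num.sqrt s <= 2000^-1, qs_const s <= 6^-1 & 4 * Num.sqrt s < 1].
Proof.
rewrite /qs_const; have := sqrtr_ge0 s.
by move=> ? ?; split; [apply/andP; split| |]; lra.
Qed.

Lemma chain_choice (P : R -> R -> R -> Prop) :
  (forall a b, a < b -> exists m, P a b m) ->
  exists f : R -> R -> R, forall a b, a < b -> P a b (f a b).
Proof.
move=> H; have /choice[f Hf] : forall q : R * R, exists m, q.1 < q.2 -> P q.1 q.2 m.
  move=> [a b]/=; have [/H[m Hm]|_] := ltP a b; last by exists 0.
  by exists m.
by exists (fun a b => f (a, b)) => a b; exact: Hf (a, b).
Qed.

Lemma qs_graph_param s G : 0 < s -> 12 * qs_const s < 1 -> s_qs_graph s G ->
  exists g u : R -> R, [/\ continuous g, G = [set p | p.2 = g p.1],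
    forall T, zygmund [set w | w = id \/ w = g] (qs_const s) T u,
    u 0 = 0 & u 1 = 1].
Proof.
move=> s0 s1 qsG; have [g cg EG] := re_homeo_graph (proj1 qsG).
have [e02 c6 s4] := qs_const_bounds s1.
have s04 : 0 < s <= 4^-1.
  have ss : Num.sqrt s * Num.sqrt s = s by rewrite -expr2 sqr_sqrtr// ltW.
  have q0 := sqrtr_ge0 s; have q4 : Num.sqrt s <= 4^-1 by lra.
  have := ler_pM q0 q0 q4 q4; rewrite ss s0/=; lra.
rewrite EG in qsG; pose W := [set w | w = id \/ w = g] : set (R -> R).
have idW : W id by left.
have contW w : W w -> continuous w by case=> [->|-> //] x; exact: cvg_id.
have bothW (P : (R -> R) -> Prop) : P id -> P g -> forall w, W w -> P w.
  by move=> Pi Pg w [->|->].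
have [mid midP] : exists mid : R -> R -> R, forall a b, a < b -> a < mid a b < b /\
    forall w, W w -> `|w a + w b - 2 * w (mid a b)| <= 12 * Num.sqrt s * (b - a).
  apply: (@chain_choice (fun a b m => a < m < b /\
    forall w, W w -> `|w a + w b - 2 * w m| <= 12 * Num.sqrt s * (b - a))) => a b ab.
  have [m [amb h1 h2]] := graph_midpoint s04 cg qsG ab.
  have le12 : 10 * Num.sqrt s * (b - a) <= 12 * Num.sqrt s * (b - a).
    by rewrite ler_wpM2r ?subr_ge0 ?(ltW ab)// ler_wpM2r// ler_nat.
  exists m; split => //; apply: bothW; [exact: le_trans h1 le12|exact: le_trans h2 le12].
have [rr rrP] : exists rr : R -> R -> R, forall a b, a < b -> b < rr a b /\
    forall w, W w -> `|w a + w (rr a b) - 2 * w b| <= 12 * Num.sqrt s * (b - a).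
  apply: (@chain_choice (fun a b m => b < m /\
    forall w, W w -> `|w a + w m - 2 * w b| <= 12 * Num.sqrt s * (b - a))) => a b ab.
  have [m [bm h1 h2]] := graph_reflect_right s04 cg qsG ab.
  by exists m; split => //; exact: bothW.
have [rl rlP] : exists rl : R -> R -> R, forall a b, a < b -> rl a b < a /\
    forall w, W w -> `|w (rl a b) + w b - 2 * w a| <= 12 * Num.sqrt s * (b - a).
  apply: (@chain_choice (fun a b m => m < a /\
    forall w, W w -> `|w m + w b - 2 * w a| <= 12 * Num.sqrt s * (b - a))) => a b ab.
  have [m [bm h1 h2]] := graph_reflect_left s04 cg qsG ab.
  by exists m; split => //; exact: bothW.
have [|u [Zu u0 u1]] := @zygmund_limit R W (qs_const s) idW contW c6; last first.
  by exists g, u.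
move=> n; have L0 : 0 < 2 * 4 ^+ n :> R by rewrite mulr_gt0// exprn_gt0.
have [u [Zu ul ur]] := net_limit e02 idW midP rrP rlP contW L0.
by apply: (zygmund_normalize idW c6 Zu (lexx _)).
Qed.

End GraphParametrization.

(** * Primitives and integration by parts *)

Section RealLine.
Context {R : realType}.
Notation mu := (@lebesgue_measure R).

Lemma integrable_segment (w : R -> R) a b : continuous w ->
  mu.-integrable `[a, b] (EFin \o w).
Proof.
move=> cw; apply: continuous_compact_integrable; first exact: segment_compact.
exact: continuous_subspaceT.
Qed.

Lemma primitive_exists (w : R -> R) : continuous w ->
  exists F : R -> R, forall x : R, is_derive x 1 F (w x).
Proof.
move=> cw.
pose I M x := (\int[mu]_(t in `[- M, x]) w t)%R.
pose F x := if 0 <= x then (\int[mu]_(t in `[0, x]) w t)%R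
            else - (\int[mu]_(t in `[x, 0]) w t)%R.
exists F => x; pose M := `|x| + 1.
have M0 : 0 < M by rewrite ltr_pwDr.
have xM : - M < x < M by rewrite -ltr_norml ltrDl.
case/andP: xM => Mx xM.
have FE y : - M <= y -> F y = I M y - I M 0.
  move=> My; rewrite /F /I; case: ifPn => y0.
    rewrite Rintegral_itvB//; last 2 first.
    - exact: integrable_segment.
    - by rewrite bnd_simp; lra.
    by rewrite Rintegral_itv_obnd_cbnd//; apply: integrableS (integrable_segment 0 y cw) => //;
      exact: subset_itv_oc_cc.
  rewrite -ltNge in y0.
  rewrite -opprB Rintegral_itvB//; last 2 first.
  - exact: integrable_segment.
  - by rewrite bnd_simp ltW.
  by rewrite Rintegral_itv_obnd_cbnd//; apply: integrableS (integrable_segment y 0 cw) => //;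
      exact: subset_itv_oc_cc.
have [dI I'] := continuous_FTC1_closed xM (integrable_segment (- M) M cw) Mx (cw x).
have DI : is_derive x 1 (fun y => I M y - I M 0) (w x - 0).
  apply: is_deriveB; rewrite -I' derive1E.
  exact: DeriveDef.
rewrite subr0 in DI; apply: near_eq_is_derive DI.
near=> y; rewrite FE//; apply: ltW; near: y; exact: lt_nbhsr.
Unshelve. all: by end_near. Qed.

Lemma constant_off_zero (K : R -> R) (r : R) : 0 < r -> {within `[- r, r], continuous K} ->
    (forall x : R, - r < x < r -> x != 0 -> is_derive x 1 K 0) ->
  K r = K (- r).
Proof.
move=> r0 cK dK; apply: (@etrans _ _ (K 0)).
- have [||c _ E] := @MVT R K (fun=> 0) 0 r r0.
  + move=> x; rewrite in_itv/= => /andP[x0 xr]; apply: dK; last by rewrite gt_eqF.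
    by apply/andP; split => //; lra.
  + by apply: continuous_subspaceW cK; apply: subset_itvr; rewrite bnd_simp; lra.
  by move: E; rewrite mul0r => /eqP; rewrite subr_eq0 => /eqP.
- have [||c _ E] := @MVT R K (fun=> 0) (- r) 0 ltac:(lra).
  + move=> x; rewrite in_itv/= => /andP[x0 xr]; apply: dK; last by rewrite lt_eqF.
    by apply/andP; split => //; lra.
  + by apply: continuous_subspaceW cK; apply: subset_itvl; rewrite bnd_simp; lra.
  by move: E; rewrite mul0r => /eqP; rewrite subr_eq0 => /eqP.
Qed.

(** On a vertical line the extension is merely continuous where it meets the real axis. The
    indefinite integral of [h] minus [H] is continuous with zero derivative off 0, hence takes equal
    values at [r] and [- r]. *)
Lemma integral_derivative_compact_support (H h : R -> R) (r : R) : 0 < r -> continuous H ->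
    (forall x : R, x != 0 -> is_derive x 1 H (h x) /\ {for x, continuous h}) ->
    (forall x, r <= `|x| -> H x = 0 /\ h x = 0) ->
    mu.-integrable setT (EFin \o h) ->
  (\int[mu]_x (h x)%:E = 0)%E.
Proof.
move=> r0 cH dH supp ih.
have ihr : mu.-integrable `[- r, r] (EFin \o h) by apply: integrableS ih.
transitivity (\int[mu]_(x in `[(- r)%R, r]) (h x)%:E)%E.
  rewrite [RHS]integral_mkcond; apply: eq_integral => x _; rewrite patchE.
  case: ifPn => //; rewrite notin_setE/= in_itv/= -ler_norml => /negP.
  by rewrite -ltNge => /ltW/supp[_ ->].
rewrite -[LHS]fineK; last exact: integrable_fin_num.
congr EFin; rewrite -/(Rintegral _ _ _).
pose I (x : R) := (\int[mu]_(t in `[- r, x]) h t)%R.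
have rr : - r < r by lra.
have : (I r - H r) = (I (- r) - H (- r)).
  apply: (@constant_off_zero (fun x => I x - H x)) => //.
    move=> x; apply: cvgB; last exact: (continuous_subspaceT cH).
    exact: (parameterized_integral_continuous (ltW rr) ihr).
  move=> x /andP[rx xr] x0; have [dHx chx] := dH x x0.
  have [dI I'] := continuous_FTC1_closed xr ihr rx chx.
  rewrite -(subrr (h x)); apply: is_deriveB.
  by rewrite -I' derive1E; exact: DeriveDef.
have r1 : r <= `|r| by exact: ler_norm.
have r2 : r <= `|- r| by rewrite normrN.
rewrite (supp r r1).1 (supp (- r) r2).1.
rewrite !subr0 /I => ->.
by rewrite set_itv1 Rintegral_set1.
Qed.

End RealLine.

(** * Square integrability and weak derivatives in the plane *)

Section Plane.
Context {R : realType}.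
Notation mu := (@lebesgue_measure R).
Local Notation plane := (measurableTypeR R * measurableTypeR R)%type.
Local Notation mu2 := (mu \x mu)%E.

(** The product sigma-algebra comes from rectangles, so the open set is written as a countable union
    of squares with rational centres. *)
Lemma measurable_open2 (O : set (R * R)) : open O -> measurable (O : set plane).
Proof.
move=> oO.
pose B (q : rat * rat * nat) : set (R * R) :=
  ball ((ratr q.1.1 : R), (ratr q.1.2 : R)) (q.2.+1%:R^-1).
have -> : O = \bigcup_q (if pselect (B q `<=` O) then B q else set0).
  apply/seteqP; split => [[x y] Oxy|p [q _]]; last by case: pselect => // BO /BO.
  have /nbhs_ballP[e /= e0 eO] := open_nbhs_nbhs (conj oO Oxy).
  have [n Hn] : exists n : nat, n.+1%:R^-1 < e / 2.
    exists (Num.truncn (e / 2)^-1).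
    rewrite -[ltRHS]invrK ltf_pV2 ?posrE ?invr_gt0 ?divr_gt0//.
    exact: truncnS_gt.
  have d0 : 0 < n.+1%:R^-1 :> R by [].
  set d := n.+1%:R^-1 in Hn d0.
  have hx : x - d < x + d by lra.
  have hy : y - d < y + d by lra.
  have [q1] := rat_in_itvoo hx; rewrite in_itv/= => /andP[q1l q1r].
  have [q2] := rat_in_itvoo hy; rewrite in_itv/= => /andP[q2l q2r].
  exists (q1, q2, n) => //; case: pselect => [BO|[]] /=.
    by split; rewrite /ball/= -/d ltr_norml; apply/andP; split; lra.
  move=> [a b] [/= ha hb]; apply: eO.
  rewrite /ball/= -/d !ltr_norml in ha hb; case/andP: ha => ? ?; case/andP: hb => ? ?.
  by split; rewrite /ball/= ltr_norml; apply/andP; split; lra.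
apply: countable_bigcupT_measurable; first exact: countableP.
move=> q; case: pselect => [BO|nBO] /=; last exact: measurable0.
rewrite [B q](_ : _ = ball (ratr q.1.1 : R) (q.2.+1%:R^-1) `*`
   ball (ratr q.1.2 : R) (q.2.+1%:R^-1)); last by [].
by apply: measurableX; rewrite ball_itv; exact: measurable_itv.
Qed.

Lemma continuous_measurable2 (f : R * R -> R) : continuous f -> measurable_fun setT (f : plane -> R).
Proof.
move=> cf; apply: (measurability _ (RGenOInfty.measurableE R)).
move=> /= _ [_ [a ->]] <-; rewrite setTI; apply: measurable_open2.
by apply: open_comp => [x _|]; [exact: cf|exact: interval_open].
Qed.

Lemma measurable_inv : measurable_fun [set: R] (fun y : R => y^-1).
Proof.
rewrite -(setvU [set 0]); apply/measurable_funU => //; first exact: measurableC.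
split; last exact: measurable_fun_set1.
apply: open_continuous_measurable_fun.
  by apply: closed_openC; exact: closed_eq.
by move=> y; rewrite inE => /eqP y0; exact: inv_continuous.
Qed.

Lemma continuous_edist0 : continuous (fun p : R * R => Defs.edist p 0).
Proof.
move=> p; apply: (@cvg_comp _ _ _ _ Num.sqrt _ (nbhs ((p.1 - 0) ^+ 2 + (p.2 - 0) ^+ 2)));
  last exact: sqrt_continuous.
have sq (f : R * R -> R) : f @ p --> f p -> (f q - 0) ^+ 2 @[q --> p] --> (f p - 0) ^+ 2.
  move=> cf; apply: (@cvg_comp _ _ _ _ (fun y : R => y ^+ 2) _ (nbhs (f p - 0))).
    by apply: cvgB => //; exact: cvg_cst.
  exact: exprn_continuous.
by apply: cvgD; apply: sq; [exact: cvg_fst|exact: cvg_snd].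
Qed.

Lemma measurable_disc r :
  measurable ([set p : R * R | Defs.edist p 0 < r] : set plane).
Proof.
apply: measurable_open2.
by apply: (@open_comp _ _ (fun p => Defs.edist p 0) `]-oo, r[%classic) => [x _|];
  [exact: continuous_edist0|exact: interval_open].
Qed.

Lemma le_edist0 (p : R * R) : `|p.1| <= Defs.edist p 0 /\ `|p.2| <= Defs.edist p 0.
Proof.
by rewrite /Defs.edist/= !subr0 -!sqrtr_sqr; split; rewrite ler_sqrt ?addr_ge0 ?sqr_ge0//
  (lerDl, lerDr) sqr_ge0.
Qed.

(** A Whitney-type decomposition of a square minus the real axis: on the [n]-th piece the distance
    to the axis is comparable to [r / 2^n]. *)
Definition shell (r : R) (n : nat) : set plane :=
  `[- r, r] `*` [set y | r / 2 ^+ n.+1 < `|y| <= r / 2 ^+ n].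

Lemma measurable_shell r n : measurable (shell r n).
Proof.
apply: measurableX => //.
rewrite (_ : [set y | _] = (@Num.norm R R) @^-1` `]r / 2 ^+ n.+1, r / 2 ^+ n]); last first.
  by apply/seteqP; split => y /=; rewrite in_itv.
rewrite -[X in measurable X]setTI; apply: continuous_measurable_fun => //.
exact: norm_continuous.
Qed.

Lemma shell_measure r n : 0 < r -> (mu2 (shell r n) <= (4 * r ^+ 2 / 2 ^+ n)%:E)%E.
Proof.
move=> r0; have p2 : 0 < r / 2 ^+ n by rewrite divr_gt0// exprn_gt0.
apply: (@le_trans _ _ (mu2 (`[- r, r] `*` `[- (r / 2 ^+ n), r / 2 ^+ n]))).
  apply: le_measure; rewrite ?inE.
  - exact: measurable_shell.
  - exact: measurableX.
  - by move=> [x y] [/= hx /andP[_ hy]]; split => //=; rewrite in_itv/= -ler_norml.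
rewrite product_measure1E//= !lebesgue_measure_itv/= !lte_fin.
rewrite !ifT ?gtrN// -!EFinB -EFinM lee_fin le_eqVlt; apply/orP; left; apply/eqP.
by field; rewrite gt_eqF// exprn_gt0.
Qed.

Lemma shell_trivIset r : 0 < r -> trivIset setT (shell r).
Proof.
move=> r0 m n _ _ [[x y] [[_ /= /andP[hm1 hm2]] [_ /= /andP[hn1 hn2]]]].
have key i j : (i < j)%N -> r / 2 ^+ i.+1 < `|y| -> `|y| <= r / 2 ^+ j -> False.
  move=> ij h1 h2; have := lt_le_trans h1 h2.
  rewrite ltr_pM2l// ltf_pV2 ?posrE ?exprn_gt0//.
  by rewrite ltNge ler_weXn2l// ler1n.
by case: (ltngtP m n) => // mn; exfalso; [exact: (key m n)|exact: (key n m)].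
Qed.

Lemma shell_cover r x y : 0 < r -> `|x| <= r -> 0 < `|y| <= r ->
  (\bigcup_n shell r n) (x, y).
Proof.
move=> r0 xr /andP[y0 yr].
have [|n /andP[n1 n2]] := @dyadic_scale R (`|y| / r).
  by rewrite divr_gt0//= ler_pdivrMr// mul1r.
have p2 k : 0 < 2 ^+ k :> R by rewrite exprn_gt0.
rewrite mulrA ler_pdivrMr// mul1r in n2.
rewrite mulrA ler_pdivlMr// in n1.
have [n1'|n1'] := ltP (r / 2) (2 ^+ n * `|y|).
  exists n => //; split; rewrite /= ?in_itv/= -?ler_norml//.
  rewrite ler_pdivlMr ?ltr_pdivrMr// exprS; apply/andP; split; lra.
exists n.+1 => //; split; rewrite /= ?in_itv/= -?ler_norml//.
rewrite ler_pdivlMr ?ltr_pdivrMr// !exprS; apply/andP; split; lra.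
Qed.

Lemma geometric_nneseries (C q : R) : 0 <= C -> 0 <= q < 1 ->
  (\sum_(n <oo) (C * q ^+ n)%:E < +oo)%E.
Proof.
move=> C0 /andP[q0 q1].
apply: (@le_lt_trans _ _ (C / (1 - q))%:E); last exact: ltry.
apply: lime_le.
  by apply: is_cvg_nneseries => n _ _; rewrite lee_fin mulr_ge0// exprn_ge0.
apply: nearW => n; rewrite sumEFin lee_fin.
rewrite ler_pdivlMr; last by rewrite subr_gt0.
suff -> : (\sum_(0 <= i < n) C * q ^+ i) * (1 - q) = C * (1 - q ^+ n).
  by rewrite ler_piMr// lerBlDr lerDl exprn_ge0.
elim: n => [|n IH]; first by rewrite big_nil mul0r expr0 subrr mulr0.
by rewrite big_nat_recr//= mulrDl IH exprS; ring.
Qed.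

(** The square of the bound grows like [(16/9)^n] while the measure of the strip decays like [2^-n]:
    the series is geometric with ratio 8/9. Vanishing on the axis settles the points of the disc
    outside all strips. *)
Lemma L2loc_shell (g : R * R -> R) : measurable_fun setT (g : plane -> R) ->
    (forall x, g (x, 0) = 0) ->
    (forall r, 0 < r -> exists C, forall n x y, `|x| <= r ->
       r / 2 ^+ n.+1 < `|y| <= r / 2 ^+ n -> `|g (x, y)| <= C * (4 / 3) ^+ n) ->
  L2loc g.
Proof.
move=> mg g0 H; split => // r.
pose rho := Num.max r 1; have rho0 : 0 < rho by rewrite lt_max ltr01 orbT.
have [C HC] := H rho rho0.
set B := [set p | _].
have mB : measurable B by exact: measurable_disc.
pose g2 (p : plane) : \bar R := (g p ^+ 2)%:E.
have mg2 : measurable_fun setT g2.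
  by apply/measurable_EFinP; exact: measurable_funX.
have mS : measurable (\bigcup_n shell rho n).
  by apply: bigcupT_measurable; exact: measurable_shell.
have g2_ge0 p : (0 <= g2 p)%E by rewrite lee_fin sqr_ge0.
suff fin : (\int[mu2]_(p in B) `|g2 p| < +oo)%E.
  rewrite /leb2; apply/integrableP; split; first exact: measurable_funTS.
  exact: fin.
apply: (@le_lt_trans _ _ (\int[mu2]_(p in \bigcup_n shell rho n) g2 p)%E).
  rewrite integral_mkcond [leRHS]integral_mkcond.
  apply: ge0_le_integral => //.
  - by move=> p _; rewrite patchE; case: ifP.
  - by apply/(measurable_restrictT _ mB); apply: measurable_funTS; exact: measurableT_comp.
  - by apply/(measurable_restrictT _ mS); exact: measurable_funTS.
  - move=> -[x y] _; rewrite !patchE; case: ifPn => [|_]; last by case: ifP.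
    rewrite inE => pB; rewrite gee0_abs//; case: ifPn => //.
    rewrite notin_setE => /= nS.
    have [y0|y0] := eqVneq y 0; first by rewrite /g2 y0 g0 expr0n.
    exfalso; apply: nS; apply: shell_cover => //.
      by apply: le_trans (le_edist0 (x, y)).1 _; rewrite ltW// (lt_le_trans pB)// le_max lexx.
    rewrite normr_gt0 y0/=.
    by apply: le_trans (le_edist0 (x, y)).2 _; rewrite ltW// (lt_le_trans pB)// le_max lexx.
rewrite ge0_integral_bigcup//; last 3 first.
- exact: measurable_shell.
- exact: measurable_funTS.
- exact: shell_trivIset.
apply: (@le_lt_trans _ _ (\sum_(n <oo) (4 * (rho * C) ^+ 2 * (8 / 9) ^+ n)%:E)%E); last first.
  apply: geometric_nneseries; last by apply/andP; split; lra.
  by rewrite mulr_ge0// sqr_ge0.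
apply: lee_nneseries => [n _ _|n _]; first exact: integral_ge0.
apply: (@le_trans _ _ (((C * (4 / 3) ^+ n) ^+ 2)%:E * mu2 (shell rho n))%E).
  rewrite -integral_cst; last exact: measurable_shell.
  apply: ge0_le_integral => //.
  - exact: measurable_shell.
  - exact: measurable_funTS.
  - move=> [x y] [/= hx hy]; rewrite lee_fin -[leLHS]real_normK ?num_real//.
    move: hx; rewrite in_itv/= -ler_norml => hx.
    have h := HC n x y hx hy.
    rewrite ler_sqr ?nnegrE//.
    exact: le_trans (normr_ge0 _) h.
apply: (@le_trans _ _ (((C * (4 / 3) ^+ n) ^+ 2)%:E * (4 * rho ^+ 2 / 2 ^+ n)%:E)%E).
  by apply: lee_wpmul2l; [rewrite lee_fin sqr_ge0|exact: shell_measure].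
rewrite -EFinM lee_fin le_eqVlt; apply/orP; left; apply/eqP.
rewrite (_ : 8 / 9 = (4 / 3) ^+ 2 / 2 :> R); last by field.
by rewrite [(_ / 2) ^+ n]exprMn exprVn -exprM mulnC exprM; field; rewrite gt_eqF// exprn_gt0.
Qed.
End Plane.

(** * Weak derivatives from derivatives along lines *)

Section WeakPartial.
Context {R : realType}.
Notation mu := (@lebesgue_measure R).
Local Notation plane := (measurableTypeR R * measurableTypeR R)%type.
Local Notation mu2 := (mu \x mu)%E.

Lemma is_derive_fst (phi : R * R -> R) (x y : R) : derivable phi (x, y) (dirv R true) ->
  is_derive x 1 (fun t => phi (t, y)) ('D_(dirv R true) phi (x, y)).
Proof.
have E : (fun h : R => h^-1 *: (phi (h *: dirv R true + (x, y)) - phi (x, y))) =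
    (fun h : R => h^-1 *: (phi (h *: 1 + x, y) - phi (x, y))).
  apply/funext => h; congr (_ *: (phi _ - _)).
  by rewrite /dirv /=; congr pair; rewrite /= scaler0 add0r.
rewrite /derivable E => d; split => //.
by rewrite /derive E.
Qed.

Lemma is_derive_snd (phi : R * R -> R) (x y : R) : derivable phi (x, y) (dirv R false) ->
  is_derive y 1 (fun t => phi (x, t)) ('D_(dirv R false) phi (x, y)).
Proof.
have E : (fun h : R => h^-1 *: (phi (h *: dirv R false + (x, y)) - phi (x, y))) =
    (fun h : R => h^-1 *: (phi (x, h *: 1 + y) - phi (x, y))).
  apply/funext => h; congr (_ *: (phi _ - _)).
  by rewrite /dirv /=; congr pair; rewrite /= scaler0 add0r.
rewrite /derivable E => d; split => //.
by rewrite /derive E.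
Qed.

Definition box (r : R) : set plane := `[- r, r] `*` `[- r, r].

Lemma in_box r (x y : R) : box r (x, y) <-> (`|x| <= r /\ `|y| <= r).
Proof. by rewrite /box/= !in_itv/= -!ler_norml. Qed.

Lemma measurable_box r : measurable (box r).
Proof. exact: measurableX. Qed.

Lemma box_finite r : (mu2 (box r) < +oo)%E.
Proof.
rewrite /box product_measure1E//= !lebesgue_measure_itv/=.
by case: ifP => _; rewrite ?mul0e ?ltry// -!EFinB -EFinM ltry.
Qed.

Lemma continuous_box_bounded (k : R * R -> R) r : continuous k ->
  exists M, 0 <= M /\ forall p, box r p -> `|k p| <= M.
Proof.
move=> ck.
have cB : compact (k @` (box r : set (R * R))).
  apply: continuous_compact; first exact: continuous_subspaceT.
  by apply: compact_setX; exact: segment_compact.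
have [M [_ HM]] := compact_bounded cB.
exists (Num.max 0 (M + 1)); rewrite le_max lexx; split => // p Bp.
apply: (HM _ _ (k p)); last by exists p.
by rewrite lt_max ltrDl ltr01 orbT.
Qed.

Lemma bounded_integrable (k : plane -> R) r M : measurable_fun setT k ->
    (forall p, box r p -> `|k p| <= M) -> (forall p, ~ box r p -> k p = 0) ->
  mu2.-integrable setT (EFin \o k).
Proof.
move=> mk kM k0.
rewrite (_ : EFin \o k = (EFin \o k) \_ (box r)); last first.
  apply/funext => p; rewrite patchE; case: ifPn => //.
  by rewrite notin_setE => /k0 /= ->.
apply/(integrable_mkcond _ (measurable_box r)).
apply: measurable_bounded_integrable.
- exact: measurable_box.
- exact: box_finite.
- exact: measurable_funTS.
- exists M; split; first exact: num_real.
  by move=> x Mx p Bp; apply: le_trans (kM p Bp) (ltW Mx).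
Qed.

Lemma test_fun_support (phi : R * R -> R) b : test_fun phi -> exists r, 0 < r /\
  forall p, ~ box r p -> phi p = 0 /\ 'D_(dirv R b) phi p = 0.
Proof.
move=> [_ [r0 H]]; pose r := Num.max r0 0 + 1.
have r0r : r0 < r by rewrite ltr_pwDr// le_max lexx.
have far p : ~ box r p -> r0 < Defs.edist p 0.
  case: p => x y /in_box /not_andP[/negP|/negP]; rewrite -ltNge => h.
    exact: lt_le_trans (lt_trans r0r h) (le_edist0 (x, y)).1.
  exact: lt_le_trans (lt_trans r0r h) (le_edist0 (x, y)).2.
exists r; split; first by rewrite ltr_pwDr// le_max lexx orbT.
move=> p /far pr; split; first exact: H.
have -> : 'D_(dirv R b) phi p = 'D_(dirv R b) (fun=> 0) p.
  apply: near_eq_derive; near=> q; apply: H.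
  by near: q; exact: (cvgr_gt _ (@continuous_edist0 R p)).
exact: derive_cst.
Unshelve. all: by end_near. Qed.

Lemma test_integrable (f g phi : R * R -> R) b : continuous f -> L2loc g ->
    test_fun phi ->
  mu2.-integrable setT (fun p : plane => (f p * 'D_(dirv R b) phi p)%:E) /\
  mu2.-integrable setT (fun p : plane => (g p * phi p)%:E).
Proof.
move=> cf [mg ig] Tphi; have [r [r0 supp]] := test_fun_support b Tphi.
have [Sphi _] := Tphi.
have cphi : continuous phi := (Sphi [::]).1.
have cD : continuous ('D_(dirv R b) phi) := (Sphi [:: b]).1.
split.
  have cfD : continuous (fun p => f p * 'D_(dirv R b) phi p).
    by move=> p; apply: cvgM; [exact: cf|exact: cD].
  have [M [_ HM]] := continuous_box_bounded r cfD.
  apply: (@bounded_integrable (fun p => f p * 'D_(dirv R b) phi p) r M) => //.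
    exact: continuous_measurable2.
  by move=> p /supp[_ ->]; rewrite mulr0.
have [M [M0 HM]] := continuous_box_bounded r cphi.
have mgphi : measurable_fun setT (fun p : plane => g p * phi p).
  by apply: measurable_funM => //; exact: continuous_measurable2.
rewrite (_ : (fun p : plane => _) = (EFin \o (fun p : plane => g p * phi p)) \_ (box r)); last first.
  apply/funext => p; rewrite patchE; case: ifPn => //.
  by rewrite notin_setE => /supp[-> _]; rewrite mulr0.
apply/(integrable_mkcond _ (measurable_box r)).
(* On the box [|g phi| <= M (1 + g^2)], and the disc of radius [2 r + 1] contains the box. *)
apply: (@le_integrable _ _ _ _ _ _ _ (EFin \o (fun p : plane => M * (1 + g p ^+ 2)))).
- exact: measurable_box.
- by apply: measurable_funTS; apply/measurable_EFinP.
- move=> p Bp; rewrite /= lee_fin normrM [leRHS]ger0_norm; last first.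
    by rewrite mulr_ge0// addr_ge0// sqr_ge0.
  rewrite mulrC; apply: ler_pM => //; first exact: HM.
  have := sqr_ge0 (`|g p| - 1); rewrite sqrrB real_normK ?num_real//; have := normr_ge0 (g p); lra.
- rewrite (_ : EFin \o _ = (fun p : plane => M%:E * (1 + (g p ^+ 2)%:E))%E); last first.
    by apply/funext => p; rewrite /= EFinM EFinD.
  apply: integrableZl; first exact: measurable_box.
  apply: integrableD; first exact: measurable_box.
    apply: (@measurable_bounded_integrable _ _ _ _ (fun=> 1)) => //.
    - exact: measurable_box.
    - exact: box_finite.
    - by exists 1; split; [exact: num_real|move=> x x1 p _; rewrite normr1 ltW].
  apply: (integrableS _ _ _ (ig (2 * r + 1))).
  + exact: measurable_disc.
  + exact: measurable_box.
  + move=> [x y] /in_box[xr yr]; apply: (@le_lt_trans _ _ (2 * r)); last by rewrite ltrDl.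
    have r2 : 0 <= 2 * r by rewrite mulr_ge0// ltW.
    rewrite -(@ler_pXn2r _ 2)// ?nnegrE ?edist_ge0// edist_sqr/= !subr0.
    rewrite -[x ^+ 2]real_normK ?num_real// -[y ^+ 2]real_normK ?num_real//.
    have := ler_pM (normr_ge0 _) (normr_ge0 _) xr xr.
    have := ler_pM (normr_ge0 _) (normr_ge0 _) yr yr.
    rewrite !expr2; have := mulr_gt0 r0 r0; lra.
Qed.
Lemma continuous_slice1 (k : R * R -> R) (y : R) : continuous k -> continuous (fun t => k (t, y)).
Proof.
move=> ck x; apply: (@cvg_comp _ _ _ (fun t => (t, y)) k _ (nbhs (x, y))); last exact: ck.
exact: (@cvg_pair _ _ _ (nbhs x) (nbhs x) (nbhs y) _ _ _ id (fun=> y) cvg_id (cvg_cst y)).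
Qed.

Lemma continuous_slice2 (k : R * R -> R) (x : R) : continuous k -> continuous (fun t => k (x, t)).
Proof.
move=> ck y; apply: (@cvg_comp _ _ _ (fun t => (x, t)) k _ (nbhs (x, y))); last exact: ck.
exact: (@cvg_pair _ _ _ (nbhs y) (nbhs x) (nbhs y) _ _ _ (fun=> x) id (cvg_cst x) cvg_id).
Qed.

Lemma weak_partial_of_integral (f g phi : R * R -> R) b :
    mu2.-integrable setT (fun p : plane => (f p * 'D_(dirv R b) phi p)%:E) ->
    mu2.-integrable setT (fun p : plane => (g p * phi p)%:E) ->
    (\int[mu2]_p (f p * 'D_(dirv R b) phi p + g p * phi p)%:E = 0)%E ->
  (\int[@leb2 R]_p (f p * 'D_(dirv R b) phi p)%:E = - \int[@leb2 R]_p (g p * phi p)%:E)%E.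
Proof.
move=> If Ig; under eq_integral do rewrite EFinD.
rewrite integralD// /leb2.
have := integrable_fin_num measurableT If; have := integrable_fin_num measurableT Ig.
move: (integral _ _ _) => a; move: (integral _ _ _) => c fa fc.
rewrite -(fineK fa) -(fineK fc) -EFinD => -[/eqP].
by rewrite addr_eq0 => /eqP ->.
Qed.

Lemma integral_slice_eq0 (h : R -> R) (F D G P : R -> R) r : 0 < r ->
    h = (fun t => F t * D t + G t * P t) ->
    continuous F -> continuous P -> continuous D -> 
    (forall x : R, is_derive x 1 P (D x)) ->
    (forall x : R, x != 0 -> is_derive x 1 F (G x) /\ {for x, continuous G}) ->
    (forall x, r <= `|x| -> P x = 0 /\ D x = 0) ->
    mu.-integrable setT (EFin \o h) -> (\int[mu]_x (h x)%:E = 0)%E.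
Proof.
move=> r0 -> cF cP cD dP dF supp ih.
apply: (@integral_derivative_compact_support R (fun t => F t * P t) _ r) => //.
- by move=> x; apply: cvgM; [exact: cF|exact: cP].
- move=> x x0; have [dFx cG] := dF x x0; split.
    have := is_deriveM dFx (dP x).
    by move=> /is_derive_eq; apply; rewrite /GRing.scale/= [P x * _]mulrC.
  by apply: cvgD; apply: cvgM; [exact: cF|exact: cD|exact: cG|exact: cP].
- by move=> x /supp[-> ->]; rewrite !mulr0 addr0.
Qed.

(** By Fubini almost every horizontal line suffices; the axis, the one line without information on
    the derivative, is null. *)
Lemma weak_partial_fst (f g : R * R -> R) : continuous f -> L2loc g ->
    (forall x y : R, y != 0 -> is_derive x 1 (fun t => f (t, y)) (g (x, y)) /\
       {for x, continuous (fun t => g (t, y))}) ->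
  weak_partial true f g.
Proof.
move=> cf Lg dg phi Tphi.
have [If Ig] := test_integrable true cf Lg Tphi.
have [r [r0 supp]] := test_fun_support true Tphi.
have [Sphi _] := Tphi.
have cphi : continuous phi := (Sphi [::]).1.
have cD : continuous ('D_(dirv R true) phi) := (Sphi [:: true]).1.
apply: weak_partial_of_integral => //.
have Ih : mu2.-integrable setT (fun p : plane =>
    (f p * 'D_(dirv R true) phi p + g p * phi p)%:E) := integrableD measurableT If Ig.
rewrite -integral21_prod_meas1//.
rewrite (@ae_eq_integral _ _ _ _ _ (cst 0%E))//; first exact: integral0.
  exact: (measurable_fubini_G Ih).
have ae0 : {ae mu, forall y : measurableTypeR R, y != 0}.
  exists [set 0]; split => //; first exact: lebesgue_measure_set1.
  by move=> y /=; case: eqVneq.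
apply: filterS2 (ae_integrable2 Ih) ae0 => y iy y0 _.
apply: (@integral_slice_eq0 _ (fun t => f (t, y)) (fun t => 'D_(dirv R true) phi (t, y))
  (fun t => g (t, y)) (fun t => phi (t, y)) (r + 1) _ erefl) => //.
- by rewrite addr_gt0.
- exact: (@continuous_slice1 _ y cf).
- exact: (@continuous_slice1 _ y cphi).
- exact: (@continuous_slice1 _ y cD).
- by move=> x; apply: is_derive_fst; exact: ((Sphi [::]).2 true (x, y)).
- by move=> x _; exact: dg.
- move=> x rx; apply: supp => /in_box[xr _].
  by move: rx; rewrite leNgt => /negP; apply; apply: le_lt_trans xr _; rewrite ltrDl.
Qed.

(** Every vertical line crosses the axis, so no line can be discarded; the exceptional point 0 in
    [integral_slice_eq0] is meant for this case. *)
Lemma weak_partial_snd (f g : R * R -> R) : continuous f -> L2loc g ->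
    (forall x y : R, y != 0 -> is_derive y 1 (fun t => f (x, t)) (g (x, y)) /\
       {for y, continuous (fun t => g (x, t))}) ->
  weak_partial false f g.
Proof.
move=> cf Lg dg phi Tphi.
have [If Ig] := test_integrable false cf Lg Tphi.
have [r [r0 supp]] := test_fun_support false Tphi.
have [Sphi _] := Tphi.
have cphi : continuous phi := (Sphi [::]).1.
have cD : continuous ('D_(dirv R false) phi) := (Sphi [:: false]).1.
apply: weak_partial_of_integral => //.
have Ih : mu2.-integrable setT (fun p : plane =>
    (f p * 'D_(dirv R false) phi p + g p * phi p)%:E) := integrableD measurableT If Ig.
rewrite -integral12_prod_meas1//.
rewrite (@ae_eq_integral _ _ _ _ _ (cst 0%E))//; first exact: integral0.
  exact: (measurable_fubini_F Ih).
apply: filterS (ae_integrable1 Ih) => x ix _.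
apply: (@integral_slice_eq0 _ (fun t => f (x, t)) (fun t => 'D_(dirv R false) phi (x, t))
  (fun t => g (x, t)) (fun t => phi (x, t)) (r + 1) _ erefl) => //.
- by rewrite addr_gt0.
- exact: (@continuous_slice2 _ x cf).
- exact: (@continuous_slice2 _ x cphi).
- exact: (@continuous_slice2 _ x cD).
- by move=> y; apply: is_derive_snd; exact: ((Sphi [::]).2 false (x, y)).
- by move=> y y0; exact: dg.
- move=> y ry; apply: supp => /in_box[_ yr].
  by move: ry; rewrite leNgt => /negP; apply; apply: le_lt_trans yr _; rewrite ltrDl.
Qed.

End WeakPartial.

(** * The Beurling-Ahlfors extension *)

Section Average.
Context {R : realType} (w W : R -> R).
Hypotheses (cw : continuous w) (dW : forall x : R, is_derive x 1 W (w x)).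
Local Notation plane := (measurableTypeR R * measurableTypeR R)%type.

Definition average (p : R * R) : R :=
  if p.2 == 0 then w p.1 else (W (p.1 + p.2) - W p.1) / p.2.

(** Here and in [average_dy], division by zero returns 0 on the axis, the value that [shell_bounded]
    asks for. *)
Definition average_dx (p : R * R) : R := (w (p.1 + p.2) - w p.1) / p.2.

Definition average_dy (p : R * R) : R := (w (p.1 + p.2) - average p) / p.2.

Lemma primitive_continuous : continuous W.
Proof.
by move=> x; apply: differentiable_continuous; apply/derivable1_diffP; case: (dW x).
Qed.

Lemma average_flip x y : average (x + y, - y) = average (x, y) \/ y = 0.
Proof.
have [->|y0] := eqVneq y 0; [by right|left].
by rewrite /average/= oppr_eq0 (negbTE y0) addrK; field.
Qed.

Lemma average_mean_pos x y : 0 < y ->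
  exists2 z, x <= z <= x + y & average (x, y) = w z.
Proof.
move=> y0; have xy : x < x + y by rewrite ltrDl.
have cW : {within `[x, x + y], continuous W}.
  by apply: continuous_subspaceT; exact: primitive_continuous.
have [z + E] := MVT xy (fun z _ => dW z) cW.
rewrite in_itv/= => /andP[xz zy]; exists z; first by rewrite !ltW.
by rewrite /average/= gt_eqF// E; field; rewrite gt_eqF.
Qed.

Lemma average_mean x y : exists2 z, `|z - x| <= `|y| & average (x, y) = w z.
Proof.
have [y0|y0|->] := ltgtP y 0; last first.
- by exists x; rewrite ?subrr ?normr0// /average/= eqxx.
- have [z /andP[xz zy] E] := @average_mean_pos x y y0; exists z => //.
  by rewrite (gtr0_norm y0) ger0_norm; lra.
have ny : 0 < - y by rewrite oppr_gt0.
have [z /andP[xz zy] E] := @average_mean_pos (x + y) (- y) ny.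
exists z.
  by rewrite addrK in zy; rewrite (ltr0_norm y0) ler0_norm; lra.
by rewrite -E; case: (average_flip x y) => // E0; rewrite E0 ltxx in y0.
Qed.

Lemma average_continuous : continuous average.
Proof.
move=> [x0 y0]; have [y00|yn0] := eqVneq y0 0; last first.
  pose h (p : R * R) := (W (p.1 + p.2) - W p.1) * p.2^-1.
  have hE : average (x0, y0) = h (x0, y0) by rewrite /average/= (negbTE yn0).
  have ch : h p @[p --> (x0, y0)] --> h (x0, y0).
    apply: cvgM.
      apply: cvgB.
        apply: (@cvg_comp _ _ _ _ W _ (nbhs (x0 + y0))); last exact: primitive_continuous.
        by apply: cvgD; [exact: cvg_fst|exact: cvg_snd].
      apply: (@cvg_comp _ _ _ _ W _ (nbhs x0)); last exact: primitive_continuous.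
      exact: cvg_fst.
    apply: (@cvg_comp _ _ _ _ (fun y : R => y^-1) _ (nbhs y0)); last exact: inv_continuous.
    exact: cvg_snd.
  rewrite /continuous_at hE; apply: cvg_trans ch; apply: near_eq_cvg; near=> p.
  rewrite /average /h ifF//; apply/negbTE; near: p.
  have : (snd p @[p --> (x0, y0)] --> y0) by exact: cvg_snd.
  by move=> /cvgr_neq0; apply.
rewrite y00; apply/cvgrPdist_lt => e e0.
have cw0 : w @ x0 --> w x0 by exact: cw.
have /cvgrPdist_lt /(_ e e0) /nbhs_ballP[d /= d0 Hd] := cw0.
have d2 : 0 < d / 2 by rewrite divr_gt0.
have cfst : q.1 @[q --> (x0, 0 : R)] --> x0 by exact: cvg_fst.
have csnd : q.2 @[q --> (x0, 0 : R)] --> (0 : R) by exact: cvg_snd.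
near=> p.
have px : `|x0 - p.1| < d / 2 by near: p; exact: (cvgrPdist_lt _ _).1 cfst _ d2.
have py : `|0 - p.2| < d / 2 by near: p; exact: (cvgrPdist_lt _ _).1 csnd _ d2.
have [z zp E] := average_mean p.1 p.2.
rewrite [average (x0, 0)]/average/= eqxx.
have -> : average p = w z by rewrite -E; case: (p).
apply: Hd; rewrite /ball/=.
have -> : x0 - z = (x0 - p.1) + (p.1 - z) by ring.
apply: le_lt_trans (ler_normD _ _) _.
rewrite sub0r normrN in py; rewrite distrC in zp; lra.
Unshelve. all: by end_near. Qed.

Lemma is_derive_shift_primitive (x y : R) : is_derive x 1 (fun t => W (t + y)) (w (x + y)).
Proof.
have := @is_derive1_comp R W (shift y) x (w (x + y)) 1 (dW (x + y)) (is_derive_shift x 1 y).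
by rewrite mulr1.
Qed.

Lemma average_partial_x (x y : R) : y != 0 ->
  is_derive x 1 (fun t => average (t, y)) (average_dx (x, y)) /\
  {for x, continuous (fun t => average_dx (t, y))}.
Proof.
move=> y0; split.
  rewrite (_ : (fun t => _) = y^-1 *: ((fun t => W (t + y)) - W)); last first.
    by apply/funext => t; rewrite /average/= (negbTE y0) mulrC.
  rewrite /average_dx/= mulrC.
  exact: (is_deriveZ _ (is_deriveB (is_derive_shift_primitive x y) (dW x))).
apply: (@cvgM _ _ _ _ (fun t => w (t + y) - w t) (fun=> y^-1)); last exact: cvg_cst.
apply: cvgB; last exact: cw.
apply: (@cvg_comp _ _ _ _ w _ (nbhs (x + y))); last exact: cw.
by apply: cvgD; [exact: cvg_id|exact: cvg_cst].
Qed.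

Lemma average_partial_y (x y : R) : y != 0 ->
  is_derive y 1 (fun t => average (x, t)) (average_dy (x, y)) /\
  {for y, continuous (fun t => average_dy (x, t))}.
Proof.
move=> y0; split.
  have d1 : is_derive y 1 (fun t => W (x + t) - W x) (w (x + y) - 0).
    apply: is_deriveB.
    rewrite (_ : (fun t => W (x + t)) = (fun t => W (t + x))); last first.
      by apply/funext => t; rewrite addrC.
    by rewrite addrC; exact: is_derive_shift_primitive.
  have d2 := @is_deriveV R id y 1 1 y0 (is_derive_id y 1).
  have d3 := is_deriveM d1 d2.
  apply: (@near_eq_is_derive _ _ _ ((fun t => W (x + t) - W x) * (fun t => (id t)^-1))).
    near=> t; rewrite /average/= ifF//; apply/negbTE; near: t.
    by apply: (@cvgr_neq0 _ _ _ _ _ id y) => //; exact: cvg_id.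
  apply: (is_derive_eq d3).
  rewrite /average_dy /average/= (negbTE y0) /GRing.scale/= subr0.
  by field.
apply: (@cvgM _ _ _ _ (fun t => w (x + t) - average (x, t)) (fun t : R => t^-1));
  last exact: inv_continuous.
apply: cvgB; last exact: (continuous_slice2 average_continuous).
apply: (@cvg_comp _ _ _ _ w _ (nbhs (x + y))); last exact: cw.
by apply: cvgD; [exact: cvg_cst|exact: cvg_id].
Unshelve. all: by end_near. Qed.

Let measurable_shift : measurable_fun setT (fun p : plane => w (p.1 + p.2)).
Proof.
apply: continuous_measurable2 => p.
apply: (@cvg_comp _ _ _ _ w _ (nbhs (p.1 + p.2))); last exact: cw.
by apply: cvgD; [exact: cvg_fst|exact: cvg_snd].
Qed.

Let measurable_inv2 : measurable_fun setT (fun p : plane => p.2^-1).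
Proof.
exact: (measurableT_comp (@measurable_inv R) measurable_snd).
Qed.

Lemma average_dx_measurable : measurable_fun setT (average_dx : plane -> R).
Proof.
apply: measurable_funM => //; apply: measurable_funB => //.
by apply: (@continuous_measurable2 _ (fun p => w p.1)) => p;
  apply: (@cvg_comp _ _ _ _ w _ (nbhs p.1)); [exact: cvg_fst|exact: cw].
Qed.

Lemma average_dy_measurable : measurable_fun setT (average_dy : plane -> R).
Proof.
apply: measurable_funM => //; apply: measurable_funB => //.
by apply: continuous_measurable2; exact: average_continuous.
Qed.

Section Estimate.
Variables (u : R -> R) (c : R).
Hypotheses (c0 : 0 <= c) (mono : forall x y, x <= y -> u x <= u y).
Hypothesis Z : forall x t, 0 < t ->
  `|w (x + t) + w (x - t) - 2 * w x| <= c * (u (x + t) - u (x - t)).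

(** The mean and the trapezoid value are both compared with the value at the midpoint [m]. The
    derivative of [k] is a second difference at [m], so by the mean value theorem the mean differs
    from [w m] by half a second difference of some step [xi < s]; the trapezoid value differs by
    half the one of step [s]. Monotonicity of [u] bounds both by the increment over the whole
    segment. *)
Let estimate_pos x y : 0 < y ->
  `|average (x, y) - (w x + w (x + y)) / 2| <= c * (u (x + y) - u x).
Proof.
move=> y0; pose s := y / 2; pose m := x + s.
have s0 : 0 < s by rewrite divr_gt0.
have ms : m - s = x by rewrite /m addrK.
have mps : m + s = x + y by rewrite /m /s; field.
pose k t := W (m + t) - W (m - t) - t * (2 * w m).
have dk (t : R) : is_derive t 1 k (w (m + t) - (- w (m - t)) - 2 * w m).
  have d1 : is_derive t 1 (fun t => W (m + t)) (w (m + t)).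
    rewrite (_ : (fun t => W (m + t)) = (fun t => W (t + m))); last first.
      by apply/funext => ?; rewrite addrC.
    by rewrite addrC; exact: is_derive_shift_primitive.
  have d2 : is_derive t 1 (fun t => W (m - t)) (- w (m - t)).
    have dW' : is_derive (m - t) 1 W (w (m - t)) by exact: dW.
    have dm : is_derive t 1 (fun t => m - t) (0 - 1).
      exact: (is_deriveB (is_derive_cst m t 1) (is_derive_id t 1)).
    have := @is_derive1_comp R W (fun t => m - t) t _ _ dW' dm.
    by rewrite sub0r mulrN1.
  have d3 : is_derive t 1 (fun t => t * (2 * w m)) (2 * w m).
    have := is_deriveM (is_derive_id t 1) (is_derive_cst (2 * w m) t 1).
    by move=> /is_derive_eq; apply; rewrite /GRing.scale/=; ring.
  exact: (is_deriveB (is_deriveB d1 d2) d3).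
have ck : continuous k.
  by move=> t; apply: differentiable_continuous; apply/derivable1_diffP; case: (dk t).
have [xi + E] := MVT s0 (fun t _ => dk t) (continuous_subspaceT ck).
rewrite in_itv/= => /andP[xi0 xis].
have Zxi := Z m xi0; have Zs := Z m s0.
have inc : u (m + xi) - u (m - xi) <= u (m + s) - u (m - s).
  by rewrite lerB// mono//; lra.
have {}Zxi := le_trans Zxi (ler_wpM2l c0 inc).
rewrite mps ms in Zs Zxi.
have k0 : k 0 = 0 by rewrite /k addr0 subr0 subrr mul0r subr0.
have ks : k s = y * (average (x, y) - w m).
  rewrite /k mps ms /average/= gt_eqF// /s; field; rewrite gt_eqF//.
rewrite k0 !subr0 ks opprK in E.
set D := c * _ in Zs Zxi *.
have av : average (x, y) - w m = 2^-1 * (w (m + xi) + w (m - xi) - 2 * w m).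
  by apply: (mulfI (lt0r_neq0 y0)); rewrite E /s; field.
rewrite (_ : _ - _ = 2^-1 * (w (m + xi) + w (m - xi) - 2 * w m) -
   2^-1 * (w (x + y) + w x - 2 * w m)); last by rewrite -av; field.
apply: le_trans (ler_normB _ _) _; rewrite !normrM ger0_norm ?invr_ge0//.
lra.
Qed.

Lemma average_estimate x y : y != 0 ->
  `|average (x, y) - (w x + w (x + y)) / 2| <= c * `|u (x + y) - u x|.
Proof.
move=> y0; have [yp|yn] := ltP 0 y.
  rewrite [in leRHS]ger0_norm; first exact: estimate_pos.
  by rewrite subr_ge0 mono// lerDl ltW.
have yn' : 0 < - y by rewrite oppr_gt0 lt_neqAle y0.
have := @estimate_pos (x + y) (- y) yn'; rewrite addrK.
have [->|E] := average_flip x y; last by rewrite E eqxx in y0.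
have -> : `|u (x + y) - u x| = u x - u (x + y).
  by rewrite ler0_norm ?opprB// subr_le0 mono// gerDl.
by rewrite [w x + _]addrC.
Qed.

End Estimate.
End Average.

Section Combinations.
Context {R : realType}.
Local Notation plane := (measurableTypeR R * measurableTypeR R)%type.
Implicit Types f g A B C D : R * R -> R.

Definition shell_bounded g := [/\ measurable_fun setT (g : plane -> R),
  (forall x, g (x, 0) = 0) &
  (forall r, 0 < r -> exists M, forall n x y, `|x| <= r ->
       r / 2 ^+ n.+1 < `|y| <= r / 2 ^+ n -> `|g (x, y)| <= M * (4 / 3) ^+ n)].

Definition partial_x f g := forall x y : R, y != 0 ->
  is_derive x 1 (fun t => f (t, y)) (g (x, y)) /\
  {for x, continuous (fun t => g (t, y))}.

Definition partial_y f g := forall x y : R, y != 0 ->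
  is_derive y 1 (fun t => f (x, t)) (g (x, y)) /\
  {for y, continuous (fun t => g (x, t))}.

Definition flip f (p : R * R) := f (p.1, - p.2).

(** Both components of the extension and all their partial derivatives are combinations of four
    functions of this kind. *)
Definition comb a b c d A B C D (p : R * R) : R :=
  a * A p + b * B p + c * C p + d * D p.

Lemma comb_continuous a b c d A B C D : continuous A -> continuous B ->
  continuous C -> continuous D -> continuous (comb a b c d A B C D).
Proof.
move=> cA cB cC cD p; rewrite /comb.
by apply: cvgD; [apply: cvgD; [apply: cvgD|]|]; apply: cvgM; try exact: cvg_cst;
  [exact: cA|exact: cB|exact: cC|exact: cD].
Qed.

Lemma flip_continuous f : continuous f -> continuous (flip f).
Proof.
move=> cf p; apply: (@cvg_comp _ _ _ (fun q : R * R => (q.1, - q.2)) f _ (nbhs (p.1, - p.2)));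
  last exact: cf.
apply: (@cvg_pair _ _ _ _ (nbhs p.1) (nbhs (- p.2)) _ _ _ (fun q : R * R => q.1)
  (fun q : R * R => - q.2)); first exact: cvg_fst.
by apply: cvgN; exact: cvg_snd.
Qed.

Lemma is_derive_comb a b c d (A B C D : R -> R) (x dA dB dC dD : R) :
  is_derive x 1 A dA -> is_derive x 1 B dB -> is_derive x 1 C dC ->
  is_derive x 1 D dD ->
  is_derive x 1 (fun t => a * A t + b * B t + c * C t + d * D t)
    (a * dA + b * dB + c * dC + d * dD).
Proof.
move=> hA hB hC hD.
exact: (is_deriveD (is_deriveD (is_deriveD (is_deriveZ a hA) (is_deriveZ b hB))
  (is_deriveZ c hC)) (is_deriveZ d hD)).
Qed.

Lemma continuous_at_comb a b c d (A B C D : R -> R) (x : R) :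
  {for x, continuous A} -> {for x, continuous B} -> {for x, continuous C} ->
  {for x, continuous D} ->
  {for x, continuous (fun t => a * A t + b * B t + c * C t + d * D t)}.
Proof.
move=> cA cB cC cD.
by apply: cvgD; [apply: cvgD; [apply: cvgD|]|]; apply: cvgM => //; exact: cvg_cst.
Qed.

Lemma partial_x_comb a b c d A B C D A' B' C' D' : partial_x A A' ->
  partial_x B B' -> partial_x C C' -> partial_x D D' ->
  partial_x (comb a b c d A B C D) (comb a b c d A' B' C' D').
Proof.
move=> hA hB hC hD x y y0.
have [dA cA] := hA x y y0; have [dB cB] := hB x y y0.
have [dC cC] := hC x y y0; have [dD cD] := hD x y y0.
by split; [exact: is_derive_comb|exact: continuous_at_comb].
Qed.

Lemma partial_y_comb a b c d A B C D A' B' C' D' : partial_y A A' ->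
  partial_y B B' -> partial_y C C' -> partial_y D D' ->
  partial_y (comb a b c d A B C D) (comb a b c d A' B' C' D').
Proof.
move=> hA hB hC hD x y y0.
have [dA cA] := hA x y y0; have [dB cB] := hB x y y0.
have [dC cC] := hC x y y0; have [dD cD] := hD x y y0.
by split; [exact: is_derive_comb|exact: continuous_at_comb].
Qed.

Lemma partial_x_flip f g : partial_x f g -> partial_x (flip f) (flip g).
Proof.
move=> h x y y0; have ny0 : - y != 0 by rewrite oppr_eq0.
exact: (h x (- y) ny0).
Qed.

Lemma partial_y_flip f g : partial_y f g ->
  partial_y (flip f) (fun p => - flip g p).
Proof.
move=> h x y y0; have ny0 : - y != 0 by rewrite oppr_eq0.
have [df cg] := h x (- y) ny0; split.
  have := @is_derive1_comp R (fun t => f (x, t)) (fun t => - t) y _ _ df (is_deriveNid y 1).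
  by rewrite mulrN1.
apply: cvgN; apply: (@cvg_comp _ _ _ (fun t => - t) (fun t => g (x, t)) _ (nbhs (- y))).
  by apply: cvgN; exact: cvg_id.
exact: cg.
Qed.

Lemma shell_bounded_comb a b c d A B C D : shell_bounded A -> shell_bounded B ->
  shell_bounded C -> shell_bounded D -> shell_bounded (comb a b c d A B C D).
Proof.
move=> [mA A0 HA] [mB B0 HB] [mC C0 HC] [mD D0 HD]; split.
- apply: measurable_funD; [apply: measurable_funD; [apply: measurable_funD|]|];
    by apply: measurable_funM => //; exact: measurable_cst.
- by move=> x; rewrite /comb A0 B0 C0 D0 !mulr0 !addr0.
- move=> r r0; have [MA {}HA] := HA r r0; have [MB {}HB] := HB r r0.
  have [MC {}HC] := HC r r0; have [MD {}HD] := HD r r0.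
  exists (`|a| * MA + `|b| * MB + `|c| * MC + `|d| * MD) => n x y xr yr.
  have {}HA := HA n x y xr yr; have {}HB := HB n x y xr yr.
  have {}HC := HC n x y xr yr; have {}HD := HD n x y xr yr.
  have tri (X Y X' Y' : R) : `|X| <= X' -> `|Y| <= Y' -> `|X + Y| <= X' + Y'.
    by move=> h1 h2; apply: le_trans (ler_normD _ _) _; exact: lerD.
  have sc (k X X' : R) : `|X| <= X' * (4 / 3) ^+ n ->
      `|k * X| <= `|k| * X' * (4 / 3) ^+ n.
    by move=> h; rewrite normrM -mulrA ler_wpM2l.
  rewrite /comb 3![in leRHS]mulrDl.
  exact: (tri _ _ _ _ (tri _ _ _ _ (tri _ _ _ _ (sc _ _ _ HA) (sc _ _ _ HB))
    (sc _ _ _ HC)) (sc _ _ _ HD)).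
Qed.

Lemma shell_bounded_flip g : shell_bounded g -> shell_bounded (flip g).
Proof.
move=> [mg g0 Hg]; split.
- apply: (@measurableT_comp _ _ _ _ _ _ (g : plane -> R) setT
    (fun p : plane => (p.1, - p.2) : plane)) => //.
  apply: measurable_fun_pair; first exact: measurable_fst.
  by apply: measurableT_comp => //; exact: measurable_snd.
- by move=> x; rewrite /flip/= oppr0.
- move=> r r0; have [M HM] := Hg r r0; exists M => n x y xr yr.
  by apply: HM => //; rewrite normrN.
Qed.

Lemma shell_boundedN g : shell_bounded g -> shell_bounded (fun p => - g p).
Proof.
move=> [mg g0 Hg]; split.
- by apply: measurableT_comp.
- by move=> x; rewrite g0 oppr0.
- move=> r r0; have [M HM] := Hg r r0; exists M => n x y xr yr.
  by rewrite normrN HM.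
Qed.

Lemma weak_partial_shell_fst f g : continuous f -> shell_bounded g ->
  partial_x f g -> L2loc g /\ weak_partial true f g.
Proof.
move=> cf [mg g0 Hg] pf; have Lg : L2loc g by exact: L2loc_shell.
by split => //; exact: weak_partial_fst.
Qed.

Lemma weak_partial_shell_snd f g : continuous f -> shell_bounded g ->
  partial_y f g -> L2loc g /\ weak_partial false f g.
Proof.
move=> cf [mg g0 Hg] pf; have Lg : L2loc g by exact: L2loc_shell.
by split => //; exact: weak_partial_snd.
Qed.

End Combinations.

Section AverageShell.
Context {R : realType} (w W : R -> R).
Hypotheses (cw : continuous w) (dW : forall x : R, is_derive x 1 W (w x)).
Hypothesis modulus : forall r, 0 < r -> exists M, forall n x s, `|x| <= r ->
  `|s| <= r / 2 ^+ n -> `|w (x + s) - w x| <= M * (2 / 3) ^+ n.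

(** An increment of order [(2/3)^n] divided by [|y|] of order [2^-n] produces the rate 4/3. *)
Let shell_quotient (r M v y : R) n : 0 < r -> `|v| <= M * (2 / 3) ^+ n ->
  r / 2 ^+ n.+1 < `|y| -> `|v / y| <= 2 * M / r * (4 / 3) ^+ n.
Proof.
move=> r0 vM ry; have p2 : 0 < 2 ^+ n.+1 :> R by rewrite exprn_gt0.
have y0 : 0 < `|y| by apply: lt_trans ry; rewrite divr_gt0.
have q0 : 0 < (2 / 3) ^+ n :> R by rewrite exprn_gt0// divr_gt0.
have M0 : 0 <= M.
  by have := le_trans (normr_ge0 v) vM; rewrite pmulr_lge0.
rewrite normrM normfV ler_pdivrMr//; apply: le_trans vM _.
have N0 : 0 <= 2 * M / r * (4 / 3) ^+ n.
  have q4 : 0 <= (4 / 3) ^+ n :> R by rewrite exprn_ge0// divr_ge0.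
  by rewrite mulr_ge0// divr_ge0 ?(ltW r0)// mulr_ge0.
apply: le_trans _ (ler_wpM2l N0 (ltW ry)).
rewrite (_ : 4 / 3 = 2 * (2 / 3) :> R); last by field.
rewrite [(2 * (2 / 3)) ^+ n]exprMn exprS; set q := (2 / 3) ^+ n; set P := 2 ^+ n.
have P0 : P != 0 by rewrite gt_eqF// exprn_gt0.
have r1 : r != 0 by rewrite gt_eqF.
rewrite (_ : _ * (r / (2 * P)) = M * q)//; field.
by rewrite r1 P0.
Qed.

Lemma average_dx_shell : shell_bounded (average_dx w).
Proof.
split; first exact: average_dx_measurable.
  by move=> x; rewrite /average_dx/= invr0 mulr0.
move=> r r0; have [M HM] := modulus r0; exists (2 * M / r) => n x y xr /andP[yl yr].
by apply: shell_quotient => //; exact: HM.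
Qed.

Lemma average_dy_shell : shell_bounded (average_dy w W).
Proof.
split; first exact: average_dy_measurable.
  by move=> x; rewrite /average_dy/= invr0 mulr0.
move=> r r0; have [M HM] := modulus r0.
exists (2 * (M + M) / r) => n x y xr /andP[yl yr].
apply: shell_quotient => //=; have [z zx ->] := average_mean dW x y.
rewrite (_ : _ - _ = (w (x + y) - w x) - (w (x + (z - x)) - w x)); last first.
  by rewrite subrKC; ring.
apply: le_trans (ler_normB _ _) _; rewrite mulrDl lerD ?HM//.
exact: le_trans zx yr.
Qed.

End AverageShell.

Section ZygmundModulus.
Context {R : realType} (Ws : set (R -> R)) (c : R) (u : R -> R).
Hypotheses (idW : Ws id) (c6 : c <= 6^-1) (Z : forall T, zygmund Ws c T u).

Lemma zygmund_monoT (x y : R) : x <= y -> u x <= u y.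
Proof.
move=> xy; apply: (zygmund_mono (@Z (y - x))).
by apply/andP; split => //; lra.
Qed.

Lemma zygmund_continuousT : continuous u.
Proof. exact: (zygmund_continuous idW c6 (@Z 1) (lexx 1)). Qed.

Lemma segment_bounded (k : R -> R) (r : R) : continuous k ->
  exists M, 0 <= M /\ forall x, `|x| <= r -> `|k x| <= M.
Proof.
move=> ck.
have ck1 : continuous (fun p : R * R => k p.1).
  by move=> p; apply: (@cvg_comp _ _ _ _ k _ (nbhs p.1)); [exact: cvg_fst|exact: ck].
have [M [M0 HM]] := continuous_box_bounded r ck1.
by exists M; split => // x xr; apply: (HM (x, x)); apply/in_box.
Qed.

Lemma zygmund_modulus (w : R -> R) (r : R) : Ws w -> continuous w -> 0 < r ->
  exists M, forall n x s, `|x| <= r -> `|s| <= r / 2 ^+ n ->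
    `|w (u (x + s)) - w (u x)| <= M * (2 / 3) ^+ n.
Proof.
move=> Ww cw r0.
have cu := zygmund_continuousT.
have cwu : continuous (fun x => w (u x)).
  by move=> x; apply: (@cvg_comp _ _ _ u w _ (nbhs (u x))); [exact: cu|exact: cw].
have [M1 [M10 H1]] := segment_bounded (3 * r) cu.
have [M2 [M20 H2]] := segment_bounded (3 * r) cwu.
exists (2 * M2 + 2 * M1) => n.
have p2 : 0 < 2 ^+ n :> R by rewrite exprn_gt0.
have q0 : 0 < (2 / 3) ^+ n :> R by rewrite exprn_gt0// divr_gt0.
(* The range is [2 * r] because a negative [s] is treated by starting from [x + s] with step [- s];
   [x + h] then stays within [3 * r]. *)
have key x s : `|x| <= 2 * r -> 0 < s <= r / 2 ^+ n ->
    `|w (u (x + s)) - w (u x)| <= (2 * M2 + 2 * M1) * (2 / 3) ^+ n.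
  move=> xr /andP[s0 sr]; pose h := s * 2 ^+ n.
  have h0 : 0 < h by rewrite mulr_gt0.
  have hr : h <= r by rewrite -ler_pdivlMr.
  have hs : h / 2 ^+ n = s by rewrite mulfK// gt_eqF.
  have := zygmund_dyadic_slope idW c6 (@Z (h / 2)) x n Ww h0.
  rewrite hs mulrC divfK// lexx => /(_ isT) H.
  have inc : 0 <= u (x + s) - u x.
    by rewrite subr_ge0; apply: zygmund_monoT; rewrite lerDl ltW.
  have x3 : `|x| <= 3 * r by apply: le_trans xr _; lra.
  have xh3 : `|x + h| <= 3 * r.
    apply: le_trans (ler_normD _ _) _; rewrite (gtr0_norm h0); lra.
  have a1 := H1 _ x3; have a2 := H1 _ xh3; have a3 := H2 _ x3; have a4 := H2 _ xh3.
  have b1 := ler_normB (w (u (x + h))) (w (u x)).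
  have b2 := le_trans (ler_norm _) (ler_normB (u (x + h)) (u x)).
  apply: (@le_trans _ _ ((2 / 3) ^+ n * (`|w (u (x + h)) - w (u x)| + (u (x + h) - u x)))).
    by apply: le_trans H; rewrite lerDl.
  by rewrite mulrC ler_wpM2r ?(ltW q0)//; lra.
move=> x s xr sr.
have [s0|s0|->] := ltgtP s 0; last first.
- rewrite addr0 subrr normr0 mulr_ge0 ?(ltW q0)//; lra.
- apply: key; first by apply: le_trans xr _; lra.
  by rewrite s0/=; apply: le_trans sr; exact: ler_norm.
have := key (x + s) (- s); rewrite addrK distrC; apply.
  apply: le_trans (ler_normD _ _) _.
  have : r / 2 ^+ n <= r by rewrite ler_pdivrMr// ler_peMr ?(ltW r0)// exprn_ege1// ler1n.
  lra.
by rewrite oppr_gt0 s0/= -normrN in sr *; apply: le_trans sr; exact: ler_norm.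
Qed.

Hypotheses (c12 : c <= 12^-1) (u0 : u 0 = 0) (u1 : u 1 = 1).

(** Doubling the step multiplies the increment from 0 by at least 3/2, so [u] is unbounded in both
    directions. *)
Lemma zygmund_surjective (y : R) : exists x, u x = y.
Proof.
have right n : (3 / 2) ^+ n <= u (2 ^+ n).
  elim: n => [|n IH]; first by rewrite !expr0 u1.
  have p2 : 0 < 2 ^+ n :> R by rewrite exprn_gt0.
  have [|_] := zygmund_half_right idW c6 (@Z (2 ^+ n)) 0 (h := 2 ^+ n).
    by rewrite p2 lexx.
  by rewrite u0 !add0r !subr0 -exprS [(3 / 2) ^+ n.+1]exprS; lra.
(* The second difference at 0 gives [|1 + u (- 1)| <= (1 - u (- 1)) / 12], hence even
   [u (- 1) <= - 11/13]. *)
have um1 : u (- 1) <= - 2^-1.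
  have [|h1 /(_ _ idW)] := @Z 1 0 1; first by rewrite ltr01 lexx.
  rewrite add0r sub0r u0 u1 in h1 * => /=.
  have := ler_wpM2r h1 c12.
  by rewrite ler_norml => ? /andP[? ?]; lra.
have left n : u (- 2 ^+ n) <= - (2^-1 * (3 / 2) ^+ n).
  elim: n => [|n IH]; first by rewrite !expr0 mulr1.
  have p2 : 0 < 2 ^+ n :> R by rewrite exprn_gt0.
  have := zygmund_half_left idW c6 (@Z (2 ^+ n)) 0 (h := 2 ^+ n).
  rewrite p2 lexx u0 !sub0r -exprS => /(_ isT).
  by rewrite [(3 / 2) ^+ n.+1]exprS; lra.
have [n Hn] := @exp_gt_exists R (3 / 2) (2 * `|y|) ltac:(lra).
have [|||x _ E] := @IVT R u (- 2 ^+ n) (2 ^+ n) y.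
- have p2 : 0 < 2 ^+ n :> R by rewrite exprn_gt0.
  lra.
- exact: continuous_subspaceT zygmund_continuousT.
- have := left n; have := right n.
  have := ler_norm y; have := ler_norm (- y); rewrite normrN => ? ? ? ?.
  by rewrite ge_min le_max; apply/andP; split; apply/orP; [left|right]; lra.
by exists x.
Qed.

End ZygmundModulus.

(** * The pointwise inequality between the complex derivatives *)

Section Pointwise.
Context {R : realType}.

Lemma sqrt_sum_sqr_le (a b : R) : Num.sqrt (a ^+ 2 + b ^+ 2) <= `|a| + `|b|.
Proof.
have ab0 : 0 <= `|a| + `|b| by rewrite addr_ge0.
rewrite -[leRHS]ger0_norm// -sqrtr_sqr ler_sqrt ?sqr_ge0//.
rewrite sqrrD !real_normK ?num_real// -addrA lerD2l lerDr.
by rewrite mulrn_wge0// mulr_ge0.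
Qed.

(** At [(x, y)] the three expressions are [y (ux - vy)], [y (vx + uy)] and [y (ux + vy)]; the
    prefixes [p] and [m] mark values at [x + y] and [x - y], [a] and [b] the means on the two sides.
    Replacing means by trapezoid values cancels the first differences in the first two and leaves
    [pu - mu] in the third. *)
Lemma beltrami_bounds (E e1 e2 pu mu u0 au bu pv mv v0 av bv : R) : e1 + e2 = E ->
  `|au - (u0 + pu) / 2| <= e1 -> `|bu - (u0 + mu) / 2| <= e2 ->
  `|av - (v0 + pv) / 2| <= e1 -> `|bv - (v0 + mv) / 2| <= e2 ->
  `|pu + mu - 2 * u0| <= E -> `|pv + mv - 2 * v0| <= E ->
  [/\ `|2^-1 * (pu - mu) - (pu - au - mu + bu) - (pv + mv - 2 * v0)
        - 2^-1 * (pv + mv - av - bv)| <= 3 * E,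
      `|(pu + mu - 2 * u0) + 2^-1 * (pv - mv) + 2^-1 * (pu + mu - au - bu)
        - (pv - av - mv + bv)| <= 3 * E &
      `|2^-1 * (pu - mu) + (pu - au - mu + bu) - (pv + mv - 2 * v0)
        + 2^-1 * (pv + mv - av - bv) - (pu - mu)| <= 3 * E].
Proof.
move=> <-; rewrite !ler_norml.
move=> /andP[? ?] /andP[? ?] /andP[? ?] /andP[? ?] /andP[? ?] /andP[? ?].
by split; apply/andP; split; lra.
Qed.

(** [i] stands for [1 / y]. As [c <= 1/12], the error [3 c K] is at most [K / 4], so
    [i X3 >= |i| K / 2], while the square root is at most [6 c |i| K]; the quotient is [12 c]. *)
Lemma reduced_ratio (i c K X1 X2 X3 k : R) : 0 <= K -> 0 <= c <= 12^-1 ->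
    (0 <= i /\ k = K) \/ (i <= 0 /\ k = - K) ->
    `|X1| <= 3 * (c * K) -> `|X2| <= 3 * (c * K) -> `|X3 - k| <= 3 * (c * K) ->
  Num.sqrt ((i * X1) ^+ 2 + (i * X2) ^+ 2) / 2 <= 12 * c * ((i * X3) / 2).
Proof.
move=> K0 /andP[c0 c12] ik h1 h2 h3.
have iX3 : `|i| * (K / 2) <= i * X3.
  have cK : c * K <= 12^-1 * K by rewrite ler_wpM2r.
  have XK : `|X3 - k| <= K / 2 by apply: le_trans h3 _; lra.
  move: XK; rewrite ler_norml => /andP[x1 x2].
  case: ik => -[i0 ->] in x1 x2 *.
    by rewrite ger0_norm// ler_wpM2l//; lra.
  rewrite ler0_norm// mulNr -mulrN ler_wnM2l//; lra.
apply: (@le_trans _ _ (3 * c * (`|i| * K))).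
  have : Num.sqrt ((i * X1) ^+ 2 + (i * X2) ^+ 2) <= `|i| * (6 * (c * K)).
    apply: le_trans (sqrt_sum_sqr_le _ _) _; rewrite !normrM -mulrDr ler_wpM2l//.
    lra.
  by set S := Num.sqrt _ => hS; nra.
have := ler_wpM2l c0 iX3; lra.
Qed.

End Pointwise.

Section Extension.
Context {R : realType} (g u : R -> R) (c : R).
Hypotheses (cg : continuous g) (c0 : 0 <= c) (c12 : 12 * c < 1).
Hypothesis Z : forall T, zygmund [set w | w = id \/ w = g] c T u.
Hypotheses (u0 : u 0 = 0) (u1 : u 1 = 1).

Let W := [set w : R -> R | w = id \/ w = g].
Let idW : W id. Proof. by left. Qed.
Let gW : W g. Proof. by right. Qed.

Let c12' : c <= 12^-1. Proof. have := c12; lra. Qed.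
Let c6 : c <= 6^-1. Proof. have := c12; lra. Qed.

Lemma reduced_qc_extension : exists f : R * R -> R * R,
  reduced_qc_with (12 * c) f /\ f @` [set p | p.2 = 0] = [set p | p.2 = g p.1].
Proof.
have cu : continuous u := zygmund_continuousT idW c6 Z.
pose v x := g (u x).
have cv : continuous v.
  by move=> x; apply: (@cvg_comp _ _ _ u g _ (nbhs (u x))); [exact: cu|exact: cg].
have [U dU] := primitive_exists cu.
have [V dV] := primitive_exists cv.
pose A := average u U; pose C := average v V.
have cA : continuous A := average_continuous cu dU.
have cC : continuous C := average_continuous cv dV.
have mU r (r0 : 0 < r) := zygmund_modulus idW c6 Z idW (fun x => cvg_id) r0.
have mV r (r0 : 0 < r) := zygmund_modulus idW c6 Z gW cg r0.
pose Ax := average_dx u; pose Cx := average_dx v.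
pose Ay := average_dy u U; pose Cy := average_dy v V.
have sAx : shell_bounded Ax := average_dx_shell cu mU.
have sCx : shell_bounded Cx := average_dx_shell cv mV.
have sAy : shell_bounded Ay := average_dy_shell cu dU mU.
have sCy : shell_bounded Cy := average_dy_shell cv dV mV.
have pAx : partial_x A Ax by move=> x y; exact: average_partial_x.
have pCx : partial_x C Cx by move=> x y; exact: average_partial_x.
have pAy : partial_y A Ay by move=> x y; exact: average_partial_y.
have pCy : partial_y C Cy by move=> x y; exact: average_partial_y.
(* With [a = A + i C], the factor i in the extension sends [C - flip C] to the real part with a
   minus sign. *)
pose f1 := comb 2^-1 2^-1 (- 1) 1 A (flip A) C (flip C).
pose f2 := comb 1 (- 1) 2^-1 2^-1 A (flip A) C (flip C).
pose ux := comb 2^-1 2^-1 (- 1) 1 Ax (flip Ax) Cx (flip Cx).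
pose vx := comb 1 (- 1) 2^-1 2^-1 Ax (flip Ax) Cx (flip Cx).
pose uy := comb 2^-1 2^-1 (- 1) 1 Ay (fun p => - flip Ay p) Cy (fun p => - flip Cy p).
pose vy := comb 1 (- 1) 2^-1 2^-1 Ay (fun p => - flip Ay p) Cy (fun p => - flip Cy p).
have cf1 : continuous f1.
  by apply: comb_continuous => //; exact: flip_continuous.
have cf2 : continuous f2.
  by apply: comb_continuous => //; exact: flip_continuous.
have sux : shell_bounded ux.
  by apply: shell_bounded_comb => //; exact: shell_bounded_flip.
have svx : shell_bounded vx.
  by apply: shell_bounded_comb => //; exact: shell_bounded_flip.
have suy : shell_bounded uy.
  by apply: shell_bounded_comb => //; apply: shell_boundedN; exact: shell_bounded_flip.
have svy : shell_bounded vy.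
  by apply: shell_bounded_comb => //; apply: shell_boundedN; exact: shell_bounded_flip.
have pux : partial_x f1 ux by apply: partial_x_comb => //; exact: partial_x_flip.
have pvx : partial_x f2 vx by apply: partial_x_comb => //; exact: partial_x_flip.
have puy : partial_y f1 uy by apply: partial_y_comb => //; exact: partial_y_flip.
have pvy : partial_y f2 vy by apply: partial_y_comb => //; exact: partial_y_flip.
have [Lux wux] := weak_partial_shell_fst cf1 sux pux.
have [Lvx wvx] := weak_partial_shell_fst cf2 svx pvx.
have [Luy wuy] := weak_partial_shell_snd cf1 suy puy.
have [Lvy wvy] := weak_partial_shell_snd cf2 svy pvy.
have f0 x : (f1 (x, 0), f2 (x, 0)) = (u x, v x).
  rewrite /f1 /f2 /comb /flip /A /C /average/= oppr0 eqxx.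
  by congr pair; field.
exists (fun p => (f1 p, f2 p)); split; last first.
  apply/seteqP; split => [_ [[x y] /= -> <-]|[a b] /= ->].
    by rewrite f0.
  have [x ux0] := zygmund_surjective idW c6 Z c12' u0 u1 a.
  by exists (x, 0) => //; rewrite f0 /v ux0.
split.
- by rewrite mulr_ge0.
- move=> p; apply: (@cvg_pair _ _ _ _ (nbhs (f1 p)) (nbhs (f2 p)) _ _ _ f1 f2).
    exact: cf1.
  exact: cf2.
- exists (0, 0), (1, 0); rewrite !f0 u0 u1 => -[/eqP].
  by rewrite eq_sym oner_eq0.
exists ux, uy, vx, vy; split => //.
apply: aeW => -[x y].
have [y0|y0] := eqVneq y 0.
  rewrite y0; case: sux => _ -> _; case: suy => _ -> _.
  case: svx => _ -> _; case: svy => _ -> _.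
  by rewrite subrr addr0 expr0n/= addr0 sqrtr0 !mul0r mulr0.
have mono := zygmund_monoT Z.
have Zu a t : 0 < t -> `|u (a + t) + u (a - t) - 2 * u a| <= c * (u (a + t) - u (a - t)).
  by move=> t0; have [|_ /(_ _ idW)] := @Z t a t; first by rewrite t0 lexx.
have Zv a t : 0 < t -> `|v (a + t) + v (a - t) - 2 * v a| <= c * (u (a + t) - u (a - t)).
  by move=> t0; have [|_ /(_ _ gW)] := @Z t a t; first by rewrite t0 lexx.
have y0' : - y != 0 by rewrite oppr_eq0.
have eA := average_estimate dU c0 mono Zu x y0.
have eB := average_estimate dU c0 mono Zu x y0'.
have eC := average_estimate dV c0 mono Zv x y0.
have eD := average_estimate dV c0 mono Zv x y0'.
(* By monotonicity [u (x + y)] and [u (x - y)] lie on opposite sides of [u x], so [K] is the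
   absolute increment over the whole symmetric interval and [u (x + y) - u (x - y)] has the sign of
   [y]. *)
pose K := `|u (x + y) - u x| + `|u (x - y) - u x|.
have [Zu' Zv' Ksign] : [/\ `|u (x + y) + u (x - y) - 2 * u x| <= c * K,
    `|v (x + y) + v (x - y) - 2 * v x| <= c * K &
    (0 <= y^-1 /\ u (x + y) - u (x - y) = K) \/
    (y^-1 <= 0 /\ u (x + y) - u (x - y) = - K)].
  rewrite /K; have [yn|yp|/eqP] := ltgtP y 0; last by rewrite (negbTE y0).
    have a1 : u (x + y) <= u x by apply: mono; rewrite gerDl ltW.
    have a2 : u x <= u (x - y) by apply: mono; rewrite lerDl oppr_ge0 ltW.
    have ny : 0 < - y by rewrite oppr_gt0.
    have -> : `|u (x + y) - u x| + `|u (x - y) - u x| = u (x - y) - u (x + y).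
      by rewrite ler0_norm ?subr_le0// ger0_norm ?subr_ge0//; ring.
    have := Zu x _ ny; have := Zv x _ ny; rewrite opprK => hv hu.
    split; [by rewrite [u (x + y) + _]addrC|by rewrite [v (x + y) + _]addrC|right].
    by rewrite invr_le0 ltW// opprB.
  have a1 : u x <= u (x + y) by apply: mono; rewrite lerDl ltW.
  have a2 : u (x - y) <= u x by apply: mono; rewrite gerDl oppr_le0 ltW.
  have -> : `|u (x + y) - u x| + `|u (x - y) - u x| = u (x + y) - u (x - y).
    by rewrite ger0_norm ?subr_ge0// ler0_norm ?subr_le0//; ring.
  by split; [exact: Zu|exact: Zv|left; rewrite invr_ge0 ltW].
have cK : c * `|u (x + y) - u x| + c * `|u (x - y) - u x| = c * K.
  by rewrite -mulrDr.
have [b1 b2 b3] := beltrami_bounds cK eA eB eC eD Zu' Zv'.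
have K0 : 0 <= K by rewrite addr_ge0.
have c012 : 0 <= c <= 12^-1 by rewrite c0 c12'.
have := reduced_ratio K0 c012 Ksign b1 b2 b3.
congr (Num.sqrt (_ ^+ 2 + _ ^+ 2) / 2 <= _ * (_ / 2));
  rewrite /ux /uy /vx /vy /comb /flip /Ax /Ay /Cx /Cy /average_dx /average_dy/= invrN; ring.
Qed.

End Extension.

(** * Choice of the constants *)

Lemma qs_const_cvg0 (R : realType) : 12 * qs_const s @[s --> at_right (0 : R)] --> (0 : R).
Proof.
apply: cvg_at_right_filter; rewrite /qs_const.
have : 12 * (3000 * (12 * Num.sqrt s)) @[s --> (0 : R)] -->
    12 * (3000 * (12 * Num.sqrt (0 : R))).
  by do 3 (apply: cvgM; first exact: cvg_cst); exact: sqrt_continuous.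
by rewrite sqrtr0 !mulr0.
Qed.

Theorem theorem1p1 (R : realType) :
  exists2 s0 : R, 0 < s0 &
  exists k : R -> R,
    [/\ (forall s, 0 < s < s0 -> 0 <= k s < 1),
        k @ at_right 0 --> 0 &
        forall (s : R) (G : set (R * R)), 0 < s < s0 -> s_qs_graph s G ->
          exists f : R * R -> R * R,
            reduced_qc_with (k s) f /\ f @` [set p | p.2 = 0] = G].
Proof.
have N0 : 0 < 12 * (3000 * 12) :> R by lra.
set N : R := 12 * (3000 * 12) in N0.
have q0 : 0 < N^-1 by rewrite invr_gt0.
(* [12 * qs_const s] equals [N * Num.sqrt s], hence the threshold [N^-2] for [s]. *)
have small s : 0 < s < N^-1 ^+ 2 -> 12 * qs_const s < 1.
  move=> /andP[s0 sq]; have : Num.sqrt s < N^-1.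
    by rewrite -[ltRHS]ger0_norm ?(ltW q0)// -sqrtr_sqr ltr_sqrt// exprn_gt0.
  rewrite -(ltr_pM2l N0) mulfV ?gt_eqF// /N /qs_const => h.
  by apply: le_lt_trans h; rewrite le_eqVlt; apply/orP; left; apply/eqP; ring.
have qs0 s : 0 <= qs_const s by rewrite /qs_const; have := sqrtr_ge0 s; lra.
exists (N^-1 ^+ 2); first by rewrite exprn_gt0.
exists (fun s => 12 * qs_const s); split; last 2 first.
- exact: qs_const_cvg0.
- move=> s G sq GG; have s0 : 0 < s by case/andP: sq.
  have [g [u [cg -> Zu u0 u1]]] := qs_graph_param s0 (small s sq) GG.
  by apply: (@reduced_qc_extension R g u (qs_const s)) => //; exact: small.
by move=> s /small ->; rewrite andbT mulr_ge0// qs0.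
Qed.
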